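(* Let $X$ be a smooth affine $\mathbb{F}_p$-scheme, let $\Lambda$ be an artinian local $\mathbb{Z}_p$-algebra with finite residue field, and let $\tilde\Lambda\to\Lambda$ be a surjection with $\tilde\Lambda$ a finite flat local $\mathbb{Z}_p$-algebra. Let $\rho:\pi_1(X)\to\mathrm{GL}_d(\Lambda)$ be a continuous representation of the arithmetic étale fundamental group of $X$. Then there exists a continuous lifting $\tilde\rho:\pi_1(X)\to\mathrm{GL}_d(\tilde\Lambda)$ of $\rho$. *)

(* Defs.v *)
(* MathComp, with the classical and topological layers of MathComp-Analysis. *)
From HB Require Import structures.
From mathcomp Require Import all_boot all_order all_algebra.
(* The notations of mpoly clash with those of the topology library. *)
From mathcomp Require Import -(notations) mpoly.
From mathcomp Require Import boolp classical_sets functions cardinality.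
From mathcomp Require Import filter topology.

Set Implicit Arguments.
Unset Strict Implicit.
Unset Printing Implicit Defensive.

Import GRing.Theory.

Local Open Scope classical_set_scope.
Local Open Scope ring_scope.

(** * The ring of p-adic integers *)

(* The inverse limit of the rings Z/p^(n+1). The ring operations make sense
   for every p, but only prime p are meant: 'Z_0 and 'Z_1 both denote Z/2. *)
Record padic_int (p : nat) := PadicInt {
  padic_val :> forall n, 'Z_(p ^ n.+1);
  padic_coherent : forall n, padic_val n.+1 = padic_val n %[mod p ^ n.+1] }.

HB.instance Definition _ (p : nat) := gen_eqMixin (padic_int p).
HB.instance Definition _ (p : nat) := gen_choiceMixin (padic_int p).

Section PadicIntRing.
Variable p : nat.
Implicit Types x y z : padic_int p.

Lemma padic_int_eq x y : (forall n, x n = y n) -> x = y.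
Proof.
case: x y => [x xP] [y yP] /= xy.
have exy : x = y by apply: functional_extensionality_dep => n; exact: xy.
by subst y; rewrite (Prop_irrelevance xP yP).
Qed.

Lemma modn_Zp_trunc n (a b : nat) : a = b %[mod p ^ n.+1] ->
  (a %% (Zp_trunc (p ^ n.+2)).+2 = b %% (Zp_trunc (p ^ n.+1)).+2
    %[mod p ^ n.+1])%N.
Proof.
case: (ltngtP p 1) => [|p_gt1|->]; last by rewrite !exp1n !modn1.
  by rewrite ltnS leqn0 => /eqP ->; rewrite !exp0n // !modn0 => ->.
have p1 k : (1 < p ^ k.+1)%N.
  by rewrite (leq_trans p_gt1) // -{1}(expn1 p) leq_exp2l.
by rewrite !Zp_cast // modn_mod modn_dvdm // dvdn_exp2l.
Qed.

Lemma padic_opp_coherent x n :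
  (- x n.+1)%R = (- x n)%R %[mod p ^ n.+1].
Proof.
apply: modn_Zp_trunc.
have := padic_coherent x n.
move: (ltnW (ltn_ord (x n.+1))) (ltnW (ltn_ord (x n))).
move: (nat_of_ord (x n.+1)) (nat_of_ord (x n)) => a b.
case: (ltngtP p 1) => [|p_gt1|->]; last by rewrite !exp1n !modn1.
  by rewrite ltnS leqn0 => /eqP ->; rewrite !exp0n // !modn0 => _ _ ->.
have p1 k : (1 < p ^ k.+1)%N.
  by rewrite (leq_trans p_gt1) // -{1}(expn1 p) leq_exp2l.
rewrite !Zp_cast // => la lb ab.
apply/eqP; rewrite -(eqn_modDr a) subnK // -modnDmr ab modnDmr subnK //.
by rewrite modnn expnS modnMl.
Qed.

Definition padic_zero : padic_int p := @PadicInt p (fun n => 0) (fun n => erefl).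

Definition padic_one : padic_int p :=
  @PadicInt p (fun n => 1) (fun n => modn_Zp_trunc erefl).

Definition padic_opp x : padic_int p :=
  @PadicInt p (fun n => - x n) (padic_opp_coherent x).

Lemma padic_add_coherent x y n :
  (x n.+1 + y n.+1)%R = (x n + y n)%R %[mod p ^ n.+1].
Proof.
by apply: modn_Zp_trunc; rewrite -modnDm !padic_coherent modnDm.
Qed.

Definition padic_add x y : padic_int p :=
  @PadicInt p (fun n => x n + y n) (padic_add_coherent x y).

Lemma padic_mul_coherent x y n :
  (x n.+1 * y n.+1)%R = (x n * y n)%R %[mod p ^ n.+1].
Proof.
by apply: modn_Zp_trunc; rewrite -modnMm !padic_coherent modnMm.
Qed.

Definition padic_mul x y : padic_int p :=
  @PadicInt p (fun n => x n * y n) (padic_mul_coherent x y).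

Lemma padic_addA : associative padic_add.
Proof. by move=> x y z; apply: padic_int_eq => n; apply: addrA. Qed.
Lemma padic_addC : commutative padic_add.
Proof. by move=> x y; apply: padic_int_eq => n; apply: addrC. Qed.
Lemma padic_add0 : left_id padic_zero padic_add.
Proof. by move=> x; apply: padic_int_eq => n; apply: add0r. Qed.
Lemma padic_addN : left_inverse padic_zero padic_opp padic_add.
Proof. by move=> x; apply: padic_int_eq => n; apply: addNr. Qed.

HB.instance Definition _ := GRing.isZmodule.Build (padic_int p)
  padic_addA padic_addC padic_add0 padic_addN.

Lemma padic_mulA : associative padic_mul.
Proof. by move=> x y z; apply: padic_int_eq => n; apply: mulrA. Qed.
Lemma padic_mulC : commutative padic_mul.
Proof. by move=> x y; apply: padic_int_eq => n; apply: mulrC. Qed.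
Lemma padic_mul1 : left_id padic_one padic_mul.
Proof. by move=> x; apply: padic_int_eq => n; apply: mul1r. Qed.
Lemma padic_mulD : left_distributive padic_mul padic_add.
Proof. by move=> x y z; apply: padic_int_eq => n; apply: mulrDl. Qed.
Lemma padic_one_neq0 : padic_one != 0.
Proof.
apply/eqP => /(congr1 (fun x : padic_int p => x 0)) /= /eqP.
by rewrite oner_eq0.
Qed.

HB.instance Definition _ := GRing.Zmodule_isComNzRing.Build (padic_int p)
  padic_mulA padic_mulC padic_mul1 padic_mulD padic_one_neq0.

End PadicIntRing.

(** * Commutative algebra *)

Definition is_ideal (R : comNzRingType) (I : set R) : Prop :=
  [/\ I 0, (forall a b, I a -> I b -> I (a + b))
    & (forall r a, I a -> I (r * a))].

Definition maximal_ideal (R : comNzRingType) (m : set R) : Prop :=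
  [/\ is_ideal m, ~ m 1
    & forall J : set R, is_ideal J -> ~ J 1 -> m `<=` J -> J = m].

Definition local_ring (R : comNzRingType) : Prop :=
  exists! m : set R, maximal_ideal m.

Definition artinian (R : comNzRingType) : Prop :=
  forall I : nat -> set R, (forall n, is_ideal (I n)) ->
    (forall n, I n.+1 `<=` I n) ->
  exists N, forall n, (N <= n)%N -> I n = I N.

(* The elements of R / m are the cosets a + m. *)
Definition finite_residue_field (R : comNzRingType) : Prop :=
  forall m : set R, maximal_ideal m ->
    finite_set (range (fun a : R => [set b | m (b - a)])).

Definition finite_module (R : nzRingType) (M : lmodType R) : Prop :=
  exists s : seq M, forall v : M, exists c : nat -> R,
    v = \sum_(i < size s) c i *: s`_i.

Definition is_tensor_product (R : comNzRingType) (M N T : lmodType R)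
    (t : {bilinear M -> N -> T}) : Prop :=
  forall (P : lmodType R) (b : {bilinear M -> N -> P}),
  exists2 g : {linear T -> P}, (forall m n, g (t m n) = b m n)
    & forall g' : {linear T -> P}, (forall m n, g' (t m n) = b m n) -> g' =1 g.

(* Tensoring with M preserves injections: g is the map induced by f from
   T, a tensor product of N and M, to T', a tensor product of N' and M. *)
Definition flat_module (R : comNzRingType) (M : lmodType R) : Prop :=
  forall (N N' : lmodType R) (f : {linear N -> N'}), injective f ->
  forall (T T' : lmodType R)
    (t : {bilinear N -> M -> T}) (t' : {bilinear N' -> M -> T'}),
    is_tensor_product t -> is_tensor_product t' ->
  forall g : {linear T -> T'}, (forall n m, g (t n m) = t' (f n) m) ->
  injective g.

Definition surjective (X Y : Type) (f : X -> Y) : Prop :=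
  forall y, exists x, f x = y.

Definition finitely_presented (R : comNzRingType) (A : comAlgType R) : Prop :=
  exists (n : nat) (phi : {lrmorphism mpoly n R -> A}) (s : seq (mpoly n R)),
    surjective phi /\
    (forall q, phi q = 0 <->
       exists c : nat -> mpoly n R, q = \sum_(i < size s) c i * s`_i).

Definition square_zero (R : comNzRingType) (C D : comAlgType R)
    (q : {lrmorphism C -> D}) : Prop :=
  surjective q /\ forall a b, q a = 0 -> q b = 0 -> a * b = 0.

(* Infinitesimal lifting. The algebras C and D are nonzero by convention; when
   D = 0 in the usual definition, C = 0 as well and nothing is asked. *)
Definition formally_smooth (R : comNzRingType) (A : comAlgType R) : Prop :=
  forall (C D : comAlgType R) (q : {lrmorphism C -> D}), square_zero q ->
  forall u : {lrmorphism A -> D},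
  exists v : {lrmorphism A -> C}, forall a, q (v a) = u a.

Definition formally_etale (R : comNzRingType) (A : comAlgType R) : Prop :=
  forall (C D : comAlgType R) (q : {lrmorphism C -> D}), square_zero q ->
  forall u : {lrmorphism A -> D},
  exists2 v : {lrmorphism A -> C}, (forall a, q (v a) = u a)
    & forall v' : {lrmorphism A -> C}, (forall a, q (v' a) = u a) -> v' =1 v.

Definition smooth_algebra (R : comNzRingType) (A : comAlgType R) : Prop :=
  finitely_presented A /\ formally_smooth A.

Definition etale_algebra (R : comNzRingType) (A : comAlgType R) : Prop :=
  finitely_presented A /\ formally_etale A.

(** * The étale fundamental group of an affine scheme *)

(* Finite étale coverings Spec B -> Spec A. The empty covering B = 0 is left
   out: its fibre is empty, so it does not affect the automorphisms below. *)
Record finite_etale (A : comNzRingType) := FiniteEtale {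
  fet_alg :> comAlgType A;
  fet_finite : finite_module fet_alg;
  fet_etale : etale_algebra fet_alg }.

(* The geometric point is Spec Omega -> Spec A. *)
Section FundamentalGroup.
Variables (A : comNzRingType) (Omega : closedFieldType).
Variable xbar : {rmorphism A -> Omega}.

(* The geometric points of Spec B over xbar, that is Hom_A(B, Omega). *)
Record fibre (B : comAlgType A) := Fibre {
  fibre_map :> {rmorphism B -> Omega};
  fibre_over : forall a : A, fibre_map a%:A = xbar a }.

Lemma fibre_eq (B : comAlgType A) (y z : fibre B) : y =1 z -> y = z.
Proof.
case: y z => [[y [[y1] [y2]]] yP] [[z [[z1] [z2]]] zP] /= yz.
have {}yz : y = z by apply: funext.
subst z; rewrite (Prop_irrelevance z1 y1) (Prop_irrelevance z2 y2) in zP *.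
by rewrite (Prop_irrelevance zP yP).
Qed.

Definition fibre_comp (B C : comAlgType A) (h : {lrmorphism B -> C})
    (z : fibre C) : fibre B.
Proof.
by exists (z \o h) => a /=; rewrite linearZ /= rmorph1 fibre_over.
Defined.

(* The automorphisms of the fibre functor B |-> Hom_A(B, Omega) on finite
   étale coverings. *)
Record pi1 := Pi1 {
  pi1_act :> forall B : finite_etale A, fibre B -> fibre B;
  pi1_bij : forall B, bijective (pi1_act (B := B));
  pi1_natural : forall (B C : finite_etale A) (h : {lrmorphism B -> C})
    (z : fibre C), pi1_act (fibre_comp h z) = fibre_comp h (pi1_act z) }.

Lemma pi1_mul_bij (s t : pi1) (B : finite_etale A) :
  bijective (fun y : fibre B => s B (t B y)).
Proof. by apply: bij_comp; apply: pi1_bij. Qed.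

Lemma pi1_mul_natural (s t : pi1) (B C : finite_etale A)
    (h : {lrmorphism B -> C}) (z : fibre C) :
  s B (t B (fibre_comp h z)) = fibre_comp h (s C (t C z)).
Proof. by rewrite !pi1_natural. Qed.

Definition pi1_mul (s t : pi1) : pi1 :=
  Pi1 (pi1_mul_bij s t) (pi1_mul_natural s t).

(* The profinite topology of pi1, induced by the product of the discrete sets
   of permutations of the fibres. pi1 is too large for the universe of
   topologicalType, hence the explicit neighbourhoods. *)
Definition pi1_nbhs (s : pi1) (U : pi1 -> Prop) : Prop :=
  exists (n : nat) (B : 'I_n -> finite_etale A),
    forall t : pi1, (forall i (y : fibre (B i)), t _ y = s _ y) -> U t.

Definition pi1_continuous (T : topologicalType) (f : pi1 -> T) : Prop :=
  forall (s : pi1) (U : set T), nbhs (f s) U -> pi1_nbhs s (fun t => U (f t)).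

End FundamentalGroup.

(** * Continuous representations *)

(* A copy of the type L, with the p-adic topology when L is a ring. *)
Definition padic_topology (p : nat) (L : Type) : Type := L.

Section PadicTopology.
Variables (p : nat) (L : comNzRingType).
Local Notation T := (padic_topology p L).

Definition padic_nbhs (a : T) : set_system T :=
  filter_from [set: nat]
    (fun n => [set b : T | exists c : L, (b : L) = (a : L) + p%:R ^+ n * c]).

Lemma padic_nbhs_filter (a : T) : ProperFilter (padic_nbhs a).
Proof.
apply: filter_from_proper => [|n _].
  apply: filter_from_filter; first by exists 0%N.
  move=> i j _ _; exists (i + j)%N => // b [c ->]; split.
    by exists (p%:R ^+ j * c); rewrite exprD mulrA.
  by exists (p%:R ^+ i * c); rewrite addnC exprD mulrA.
by exists a; exists 0; rewrite mulr0 addr0.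
Qed.

Lemma padic_nbhs_singleton (a : T) (U : set T) : padic_nbhs a U -> U a.
Proof. by move=> [n _]; apply; exists 0; rewrite mulr0 addr0. Qed.

Lemma padic_nbhs_nbhs (a : T) (U : set T) :
  padic_nbhs a U -> padic_nbhs a (padic_nbhs^~ U).
Proof.
move=> [n _ nU]; exists n => // _ [c ->]; exists n => // _ [d ->].
by apply: nU; exists (c + d); rewrite mulrDr addrA.
Qed.

HB.instance Definition _ := Choice.on T.
HB.instance Definition _ := hasNbhs.Build T padic_nbhs.
HB.instance Definition _ := Nbhs_isNbhsTopological.Build T
  padic_nbhs_filter padic_nbhs_singleton padic_nbhs_nbhs.

End PadicTopology.

(* Continuous homomorphisms from pi1 to GL_d(L). A finite Z_p-algebra carries
   the p-adic topology; it is discrete if L is artinian local with finite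
   residue field, as p is then nilpotent in L. *)
Definition continuous_representation (A : comNzRingType)
    (Omega : closedFieldType) (xbar : {rmorphism A -> Omega}) (p d : nat)
    (L : comUnitAlgType (padic_int p)) (rho : pi1 xbar -> 'M[L]_d) : Prop :=
  [/\ forall s, rho s \in unitmx,
      forall s t, rho (pi1_mul s t) = rho s *m rho t
    & pi1_continuous (rho : pi1 xbar -> 'M[padic_topology p L]_d)].

(* Main.v *)
(* An affine scheme X = Spec A over F_p satisfies H^2(pi1, V) = 0 for every finite
   F_p[pi1]-module V, by Artin-Schreier theory. Hence a
   continuous homomorphism from pi1 to a quotient E / N of a finite group lifts to E
   when N is a p-group. For large n, the surjections GL_d(Lt / p^n) -> GL_d(L) and
   GL_d(Lt / p^(n+1)) -> GL_d(Lt / p^n) have p-groups as kernels, and Lt is the limit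
   of the Lt / p^n.

   If V is split by a finite Galois covering B of A
   with group H, a 2-cocycle c becomes the coboundary of some e : H -> V (x) B since B
   contains an element of trace 1. For the same reason F e - e, with F the Frobenius
   of B, is the coboundary of some f in V (x) B. The Artin-Schreier covering
   F y - y = f of B is then a torsor under the extension of H by V defined by c, and
   the action of pi1 on its fibre provides the lift. *)
From HB Require Import structures.
From mathcomp Require Import all_boot all_order all_algebra.
From mathcomp Require Import all_fingroup all_solvable all_field all_character.
From mathcomp Require Import ring_quotient.
From mathcomp Require Import -(notations) mpoly.
From mathcomp Require Import boolp classical_sets functions cardinality.
From mathcomp Require Import filter topology.
Require Import Defs.

Set Implicit Arguments.
Unset Strict Implicit.
Unset Printing Implicit Defensive.

Import GRing.Theory.
Local Open Scope ring_scope.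

(** * Quotients, algebras and polynomials *)

(** Spec A may be disconnected, and no connected Galois covering is constructed. Its place is taken
    by the scheme Spec B of n-tuples of pairwise distinct points of a covering Spec C, where n
    counts the geometric points of C over xbar and S_n permutes the coordinates. The group H is the
    image of pi1 in S_n. The invariants of B may differ from A; what remains of the Galois property
    is a pair of dual bases with sum_k X_k s(Y_k) equal to 1 for s = 1 and to 0 otherwise. This
    yields both the element of trace 1 and the freeness of the action at a geometric point.

    Finite étale algebras are given by generators and relations and used through their universal
    property; identities in C (x) C are tested on pairs of morphisms out of C. As rings are nonzero
    by convention, each construction asks for a point of the algebra to be built, which the closed
    field Omega supplies.

    A homomorphism to a quotient group or to matrices over a quotient ring is carried as a mere
    function to the group or ring above, multiplicative up to a normal subgroup or an ideal. *)

Local Notation mvar i := (mpolyX _ (mnm1 i)).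

Section QuotientRing.
Variables (R : comNzRingType) (I : set R).
Hypotheses (idI : is_ideal I) (properI : ~ I 1).

(** Both hypotheses are parameters, so that the structure of proper ideal, and with it a nonzero
    quotient ring, can be inferred from the predicate. *)
Let ipred & is_ideal I & ~ I 1 : {pred R} := fun x => `[< I x >].

Fact ipred_ideal : idealr_closed (ipred idI properI).
Proof.
case: idI => I0 ID IM; split; first exact/asboolP.
  by apply/asboolP.
move=> a x y /asboolP xI /asboolP yI; apply/asboolP.
by apply: ID => //; apply: IM.
Qed.

HB.instance Definition _ := isIdealr.Build R (ipred idI properI) ipred_ideal.

Lemma quotient_exists : exists (Q : comNzRingType) (q : {rmorphism R -> Q}),
  Defs.surjective q /\ forall x, q x = 0 <-> I x.
Proof.
exists {ideal_quot (ipred idI properI)}, (\pi_{ideal_quot (ipred idI properI)})%qT.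
split=> [y|x]; first by exists (generic_quotient.repr y); apply: reprK.
have -> : (\pi_{ideal_quot ipred idI properI} x = 0)%qT <->
          x \in ipred idI properI.
  rewrite -[0](rmorph0 (\pi_{ideal_quot (ipred idI properI)})%qT).
  split=> [/eqP|]; first by rewrite -Quotient.idealrBE subr0.
  by move=> xI; apply/eqP; rewrite -Quotient.idealrBE subr0.
by split=> /asboolP.
Qed.

End QuotientRing.

Lemma factor_rmorphism (R Q T : comNzRingType) (q : {rmorphism R -> Q})
    (h : {rmorphism R -> T}) :
  Defs.surjective q -> (forall x, q x = 0 -> h x = 0) ->
  exists h' : {rmorphism Q -> T}, forall x, h' (q x) = h x.
Proof.
move=> qS kerS; pose s y := sval (cid (qS y)).
have qs y : q (s y) = y by rewrite /s; case: cid.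
have hs x y : q x = q y -> h x = h y.
  by move=> exy; apply/eqP; rewrite -subr_eq0 -rmorphB kerS // rmorphB exy subrr.
pose h' y := h (s y).
have h'B : zmod_morphism h'.
  by move=> x y; rewrite /h' -rmorphB; apply: hs; rewrite rmorphB !qs.
have h'M : monoid_morphism h'.
  split=> [|x y]; first by rewrite /h' -[RHS](rmorph1 h); apply: hs; rewrite qs rmorph1.
  by rewrite /h' -rmorphM; apply: hs; rewrite rmorphM !qs.
pose H := HB.pack_for {rmorphism Q -> T} h'
  (GRing.isZmodMorphism.Build _ _ h' h'B) (GRing.isMonoidMorphism.Build _ _ h' h'M).
by exists H => x; rewrite /= /h'; apply: hs; rewrite qs.
Qed.

Section AlgebraOf.
Variables (A Q : comNzRingType) (i : {rmorphism A -> Q}).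

(** A copy of [Q] indexed by [i], so that the algebra structure can be inferred from the type. *)
Definition algebra_of & {rmorphism A -> Q} : Type := Q.
Local Notation T := (algebra_of i).

HB.instance Definition _ := GRing.ComNzRing.on T.

Let scale (a : A) (x : T) : T := (i a : T) * x.

Fact algebra_of_scaleA a b x : scale a (scale b x) = scale (a * b) x.
Proof. by rewrite /scale rmorphM mulrA. Qed.
Fact algebra_of_scale1 : left_id 1 scale.
Proof. by move=> x; rewrite /scale rmorph1 mul1r. Qed.
Fact algebra_of_scaleDr : right_distributive scale +%R.
Proof. by move=> a x y; rewrite /scale mulrDr. Qed.
Fact algebra_of_scaleDl x : {morph scale^~ x : a b / a + b}.
Proof. by move=> a b; rewrite /scale rmorphD mulrDl. Qed.

HB.instance Definition _ := GRing.Zmodule_isLmodule.Build A T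
  algebra_of_scaleA algebra_of_scale1 algebra_of_scaleDr algebra_of_scaleDl.

Fact algebra_of_scaleAl (a : A) (x y : T) : a *: (x * y) = a *: x * y.
Proof. exact: mulrA. Qed.

HB.instance Definition _ := GRing.Lmodule_isLalgebra.Build A T algebra_of_scaleAl.

Fact algebra_of_scaleAr (a : A) (x y : T) : a *: (x * y) = x * (a *: y).
Proof. exact: mulrCA. Qed.

HB.instance Definition _ := GRing.Lalgebra_isAlgebra.Build A T algebra_of_scaleAr.
HB.instance Definition _ := GRing.ComAlgebra.on T.

Lemma algebra_exists : exists (B : comAlgType A) (j : {rmorphism Q -> B}),
  bijective j /\ forall a, j (i a) = a%:A.
Proof.
exists T, (idfun : Q -> Q); split=> [|a]; first by exists idfun.
by rewrite /GRing.scale /= /scale mulr1.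
Qed.

End AlgebraOf.

Lemma lrmorphism_of (A : comNzRingType) (B C : comAlgType A)
    (f : {rmorphism B -> C}) : (forall a, f a%:A = a%:A) ->
  exists g : {lrmorphism B -> C}, g =1 f.
Proof.
move=> fA; have fZ : scalable f.
  by move=> a x; rewrite -mulr_algl rmorphM fA mulr_algl.
pose g := HB.pack_for {lrmorphism B -> C} (f : B -> C)
  (GRing.isScalable.Build _ _ _ _ (f : B -> C) fZ)
  (GRing.RMorphism.on (f : B -> C)).
by exists g.
Qed.

Lemma mpoly_closed_ind (n : nat) (R : comNzRingType) (P : mpoly n R -> Prop) :
  (forall c, P (mpolyC n c)) -> (forall i, P (mvar i)) ->
  (forall x y, P x -> P y -> P (x + y)) ->
  (forall x y, P x -> P y -> P (x * y)) -> forall x, P x.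
Proof.
move=> PC PX PD PM x; rewrite (mpolyE x).
have P0 : P 0 by rewrite -(mpolyC0 n R).
apply: (big_ind P) => // m _; rewrite -mul_mpolyC; apply: (PM _ _ (PC _)).
rewrite mpolyXE_id; apply: (big_ind P) => //; first by rewrite -(mpolyC1 n R).
move=> i _; elim: (m i) => [|k IHk]; first by rewrite expr0 -(mpolyC1 n R).
by rewrite exprS; apply: PM.
Qed.

Section MatrixTrick.
Variables (R : comNzRingType) (n : nat).

(** The matrix [1 - M] kills the column [x]; multiply by its adjugate. *)
Lemma det_sub1_annihilates (M : 'M[R]_n) (x : 'I_n -> R) :
  (forall i, x i = \sum_j M i j * x j) -> forall i, \det (1%:M - M) * x i = 0.
Proof.
move=> Mx i; have Nx : (1%:M - M) *m (\col_k x k) = 0.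
  apply/colP=> k; rewrite mulmxBl mul1mx !mxE {1}Mx; apply/eqP.
  by rewrite subr_eq0; apply/eqP/eq_bigr => j _; rewrite mxE.
have : (\adj (1%:M - M) *m (1%:M - M)) *m (\col_k x k) = 0.
  by rewrite -mulmxA Nx mulmx0.
by rewrite mul_adj_mx mul_scalar_mx => /colP/(_ i); rewrite !mxE.
Qed.

End MatrixTrick.

Lemma mpoly_rmorphism_ext (n : nat) (R T : comNzRingType)
    (f g : {rmorphism mpoly n R -> T}) :
  (forall c, f (mpolyC n c) = g (mpolyC n c)) ->
  (forall i, f (mvar i) = g (mvar i)) -> f =1 g.
Proof.
move=> eC eX; apply: mpoly_closed_ind => // x y ex ey.
  by rewrite !rmorphD ex ey.
by rewrite !rmorphM ex ey.
Qed.

Lemma mmap_rmorphism (n : nat) (R T : comNzRingType) (h : {rmorphism R -> T})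
    (t : 'I_n -> T) : exists f : {rmorphism mpoly n R -> T},
  [/\ f =1 mmap h t, forall c, f (mpolyC n c) = h c & forall i, f (mvar i) = t i].
Proof.
pose f : {rmorphism mpoly n R -> T} := mmap h t.
by exists f; split=> // [c|i]; [apply: mmapC|rewrite /= mmapX mmap1U].
Qed.

(** The image of [sum_k x_k (x) y_k] under the map from C (x) C to T given by [f] and [g]. *)
Definition pairing (C : comNzRingType) (m : nat) (x y : 'I_m -> C)
    (T : comNzRingType) (f g : C -> T) : T := \sum_k f (x k) * g (y k).

(** This says that [sum_k x_k (x) y_k] is the idempotent of the diagonal of Spec C (x) C:
    multiplication sends it to 1, and every c (x) 1 - 1 (x) c annihilates it. The second condition
    is tested on all pairs of morphisms in place of C (x) C. *)
Definition separating (A : comNzRingType) (C : comAlgType A) (m : nat)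
    (x y : 'I_m -> C) : Prop :=
  \sum_k x k * y k = 1 /\
  forall (T : comNzRingType) (f g : {rmorphism C -> T}),
    (forall a : A, f a%:A = g a%:A) ->
  forall c, pairing x y f g * f c = pairing x y f g * g c.

(* The kernel J of the multiplication C (x) C -> C satisfies J = J^2, as C is
   formally unramified; being finitely generated, it is generated by an
   idempotent, whose complement is the element sum_k x_k (x) y_k. *)
Lemma etale_separating (A : comNzRingType) (C : comAlgType A) :
  etale_algebra C -> exists (m : nat) (x y : 'I_m -> C), separating x y.
Proof.
move=> [[k [phi [s [phiS kerphi]]]] C_etale].
pose xi i := phi (mvar i).
(* C (x) C is C[X_1, ..., X_k] modulo the images under [j2] of the relations of C; [ev] induces its
   multiplication, whose kernel J is generated by the [D i]. *)
pose cst : {rmorphism A -> mpoly k C} := (@mpolyC k C \o GRing.in_alg C)%FUN.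
have [j2 [_ j2C j2X]] := mmap_rmorphism cst (fun i : 'I_k => mvar i).
have [ev [evE evC evX]] := mmap_rmorphism (idfun : {rmorphism C -> C}) xi.
pose D i : mpoly k C := mvar i - mpolyC k (xi i).
have DE i : D i = mvar i - mpolyC k (xi i) by [].
clearbody D.
have evD i : ev (D i) = 0 by rewrite DE rmorphB evX evC subrr.
have evj2 P : ev (j2 P) = phi P.
  move: P; apply: (@mpoly_rmorphism_ext _ _ _ (ev \o j2)%FUN) => [c|i] /=.
    by rewrite j2C evC /= -(mul1r (mpolyC k c)) mulrC mul_mpolyC linearZ /= rmorph1.
  by rewrite j2X evX.
have phis (l : 'I_(size s)) : phi s`_l = 0.
  apply/kerphi; exists (fun i => (i == l :> nat)%:R).
  rewrite (bigD1 l) //= eqxx mul1r big1 ?addr0 // => i /negPf.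
  by rewrite -val_eqE /= => ->; rewrite mul0r.
(* The quotient by [I2] is C (x) C; the quotient by [I], below, is (C (x) C) / J^2. *)
pose I2 (P : mpoly k C) := exists c : 'I_(size s) -> mpoly k C,
  P = \sum_l c l * j2 s`_l.
have idI2 : is_ideal I2.
  split.
  - by exists (fun=> 0); rewrite big1 // => l _; rewrite mul0r.
  - move=> _ _ [c ->] [c' ->]; exists (fun l => c l + c' l).
    by rewrite -big_split; apply: eq_bigr => l _; rewrite mulrDl.
  - move=> r _ [c ->]; exists (fun l => r * c l).
    by rewrite mulr_sumr; apply: eq_bigr => l _; rewrite mulrA.
have [I20 I2D I2M] := idI2.
pose I (P : mpoly k C) := exists g : 'I_k -> 'I_k -> mpoly k C,
  I2 (P - \sum_i \sum_j g i j * (D i * D j)).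
have idI : is_ideal I.
  split.
  - exists (fun _ _ => 0); rewrite big1 ?subr0 // => i _.
    by rewrite big1 // => j _; rewrite mul0r.
  - move=> a b [g ga] [g' gb]; exists (fun i j => g i j + g' i j).
    refine (eq_ind _ I2 (I2D _ _ ga gb) _ _).
    rewrite addrACA -opprD -big_split /=; congr (_ - _).
    apply: eq_bigr => i _; rewrite -big_split /=.
    by apply: eq_bigr => j _; rewrite mulrDl.
  - move=> r a [g ga]; exists (fun i j => r * g i j).
    refine (eq_ind _ I2 (I2M r _ ga) _ _).
    rewrite mulrBr mulr_sumr; congr (_ - _); apply: eq_bigr => i _; rewrite mulr_sumr.
    by apply: eq_bigr => j _; apply: mulrA.
have evI P : I P -> ev P = 0.
  move=> [g [c]] /eqP; rewrite subr_eq => /eqP ->.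
  rewrite rmorphD !rmorph_sum big1 ?add0r => [|l _].
    by rewrite big1 // => i _; rewrite rmorph_sum big1 // => j _; rewrite !rmorphM evD mul0r mulr0.
  by rewrite rmorphM evj2 phis mulr0.
have properI : ~ I 1 by move/evI/eqP; rewrite rmorph1 oner_eq0.
have [Q0 [q0 [q0S kerq0]]] := quotient_exists idI properI.
have [Q [jQ [[jQ' jQK jQ'K] jQA]]] := algebra_exists (q0 \o cst)%FUN.
pose qq : {rmorphism mpoly k C -> Q} := (jQ \o q0)%FUN.
have qqS : Defs.surjective qq.
  by move=> y; have [x xy] := q0S (jQ' y); exists x; rewrite /= xy.
have kerqq P : qq P = 0 <-> I P.
  rewrite -kerq0; split=> [|/= ->]; last by rewrite rmorph0.
  by move=> qP; rewrite -(jQK (q0 P)) [jQ _]qP -[RHS](jQK 0) rmorph0.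
have qqA a : qq (cst a) = a%:A by apply: jQA.
have [qr qrE] : exists q : {rmorphism Q -> C}, forall x, q (qq x) = ev x.
  by apply: factor_rmorphism => // x /kerqq/evI.
have [q qE] : exists q : {lrmorphism Q -> C}, q =1 qr.
  by apply: lrmorphism_of => a; rewrite -qqA qrE evC.
have qsq : square_zero q.
  split=> [c|]; first by exists (qq (mpolyC k c)); rewrite qE qrE evC.
  have spanD P : exists c : 'I_k -> mpoly k C, P - mpolyC k (ev P) = \sum_i c i * D i.
    move: P; apply: mpoly_closed_ind => [c|i|x y [c ex] [c' ey]|x y [c ex] [c' ey]].
    - by exists (fun=> 0); rewrite evC subrr big1 // => i _; rewrite mul0r.
    - exists (fun l => (l == i)%:R); rewrite (bigD1 i) //= eqxx mul1r evX DE.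
      by rewrite big1 ?addr0 // => l /negPf ->; rewrite mul0r.
    - exists (fun i => c i + c' i); rewrite rmorphD mpolyCD opprD addrACA ex ey.
      by rewrite -big_split; apply: eq_bigr => l _; rewrite mulrDl.
    - exists (fun i => c i * y + mpolyC k (ev x) * c' i).
      rewrite rmorphM mpolyCM.
      have -> : x * y - mpolyC k (ev x) * mpolyC k (ev y) =
        (x - mpolyC k (ev x)) * y + mpolyC k (ev x) * (y - mpolyC k (ev y)).
        by rewrite mulrBl mulrBr addrA subrK.
      rewrite ex ey mulr_suml mulr_sumr -big_split /=.
      by apply: eq_bigr => l _; rewrite mulrDl mulrAC mulrA.
  move=> a b; have [a' <-] := qqS a; have [b' <-] := qqS b.
  rewrite !qE !qrE => a0 b0; rewrite -rmorphM; apply/kerqq.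
  have [c] := spanD a'; have [c'] := spanD b'.
  rewrite a0 b0 mpolyC0 !subr0 => -> ->.
  exists (fun i j => c i * c' j).
  have -> : (\sum_i c i * D i) * (\sum_i c' i * D i) =
     \sum_i \sum_j c i * c' j * (D i * D j).
    rewrite mulr_suml; apply: eq_bigr => i _; rewrite mulr_sumr.
    by apply: eq_bigr => l _; rewrite mulrACA.
  by rewrite subrr.
(* The two coprojections from C to (C (x) C) / J^2. Both lift the identity of C along the
   square-zero map [q], hence coincide, so that each [D i] lies in J^2. *)
have [v1 v1E] : exists v : {lrmorphism C -> Q}, v =1 (qq \o @mpolyC k C)%FUN.
  by apply: lrmorphism_of => a; apply: qqA.
have [v2r v2rE] : exists v : {rmorphism C -> Q}, forall P, v (phi P) = (qq \o j2)%FUN P.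
  apply: factor_rmorphism => // P /kerphi [c ->]; apply/kerqq.
  exists (fun _ _ => 0); rewrite [X in _ - X]big1 ?subr0 => [|i _]; last first.
    by rewrite big1 // => l _; rewrite mul0r.
  by rewrite rmorph_sum; exists (fun l => j2 (c l)); apply: eq_bigr => l _; rewrite rmorphM.
have [v2 v2E] : exists v : {lrmorphism C -> Q}, v =1 v2r.
  apply: lrmorphism_of => a; rewrite -[in LHS](rmorph1 phi) -linearZ v2rE -qqA.
  by rewrite /= -mul_mpolyC mulr1 j2C.
have [v vE v_uniq] := C_etale _ _ q qsq (idfun : {lrmorphism C -> C}).
have Dsq i : exists g : 'I_k -> 'I_k -> mpoly k C,
    I2 (D i - \sum_j \sum_l g j l * (D j * D l)).
  apply/kerqq; rewrite DE rmorphB; apply/eqP; rewrite subr_eq0; apply/eqP.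
  transitivity (v2 (xi i)); first by rewrite v2E /xi v2rE /= j2X.
  transitivity (v1 (xi i)); last by rewrite v1E.
  have -> : v1 =1 v by apply: v_uniq => c; rewrite v1E qE qrE evC.
  apply: v_uniq => c; have [P <-] := phiS c; rewrite v2E v2rE qE qrE; exact: evj2.
have {Dsq} [g gE] := choice Dsq.
(* Modulo [I2], [H] fixes the column of the [D i], so [e = det (1 - H)] annihilates them; as the
   entries of [H] lie in J, [e] is 1 on the diagonal. *)
pose H : 'M[mpoly k C]_k := \matrix_(i, j) \sum_l g i j l * D l.
pose e := \det (1%:M - H).
have eD i : I2 (e * D i).
  have -> : e * D i = \sum_j (\adj (1%:M - H)) i j * (D j - \sum_l H j l * D l).
    have -> : e * D i = ((\adj (1%:M - H) *m (1%:M - H)) *m (\col_l D l)) i 0.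
      by rewrite mul_adj_mx mul_scalar_mx !mxE.
    rewrite -mulmxA mxE; apply: eq_bigr => j _; congr (_ * _).
    rewrite mulmxBl mul1mx !mxE; congr (_ - _).
    by apply: eq_bigr => l _; rewrite !mxE.
  apply: (big_ind I2) => // j _; apply: I2M.
  refine (eq_ind _ I2 (gE j) _ _); congr (_ - _); apply: eq_bigr => l _.
  by rewrite mxE mulr_suml; apply: eq_bigr => u _; rewrite -mulrA (mulrC (D l)).
have eve : ev e = 1.
  rewrite -det_map_mx map_mxB map_mx1.
  suff -> : map_mx ev H = 0 by rewrite subr0 det1.
  apply/matrixP=> i l; rewrite !mxE rmorph_sum big1 // => u _.
  by rewrite rmorphM evD mulr0.
(* Each term of [e] is a coefficient in the first factor C times a monomial in the generators of the
   second. *)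
pose ms := msupp e; exists (size ms).
exists (fun i => mcoeff (tnth (in_tuple ms) i) e), (fun i => mmap1 xi (tnth (in_tuple ms) i)).
have sumE (T : comNzRingType) (F : multinom k -> T) :
    \sum_(i < size ms) F (tnth (in_tuple ms) i) = \sum_(m <- ms) F m.
  by rewrite [RHS](big_tnth 0 +%R ms xpredT F).
split; first by rewrite (sumE _ (fun m => mcoeff m e * mmap1 xi m)) -[RHS]eve evE.
move=> T f h fh c.
have [F [FE FC FX]] := mmap_rmorphism f (fun i => h (xi i)).
have pE : pairing (fun i => mcoeff (tnth (in_tuple ms) i) e)
    (fun i => mmap1 xi (tnth (in_tuple ms) i)) f h = F e.
  rewrite /pairing (sumE _ (fun m => f (mcoeff m e) * h (mmap1 xi m))) FE.
  apply: eq_bigr => m _; congr (_ * _); rewrite /mmap1 rmorph_prod.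
  by apply: eq_bigr => i _; rewrite rmorphXn.
rewrite pE.
have Fj2 P : F (j2 P) = h (phi P).
  move: P; apply: (@mpoly_rmorphism_ext _ _ _ (F \o j2)%FUN (h \o phi)%FUN) => [a|i] /=.
    rewrite j2C FC /= -[in RHS](mulr1 (mpolyC k a)) mul_mpolyC linearZ /= rmorph1; exact: fh.
  by rewrite j2X FX.
have FI2 P : I2 P -> F P = 0.
  move=> [u ->]; rewrite rmorph_sum big1 // => l _.
  by rewrite rmorphM Fj2 phis rmorph0 mulr0.
have Fxi i : F e * f (xi i) = F e * h (xi i).
  apply/esym/eqP; rewrite -subr_eq0 -mulrBr; have /FI2 := eD i.
  by rewrite DE rmorphM rmorphB FX FC => ->.
have [P <-] := phiS c.
move: P; apply: mpoly_closed_ind => [a|i|x y ex ey|x y ex ey].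
- by rewrite -(mulr1 (mpolyC k a)) mul_mpolyC linearZ /= rmorph1 fh.
- exact: Fxi.
- by rewrite !rmorphD !mulrDr ex ey.
- by rewrite !rmorphM !mulrA ex mulrAC ey mulrAC.
Qed.

Definition gen_ideal (R : comNzRingType) (s : seq R) : set R :=
  fun x => exists c : nat -> R, x = \sum_(i < size s) c i * s`_i.

Lemma is_ideal_gen (R : comNzRingType) (s : seq R) : is_ideal (gen_ideal s).
Proof.
split.
- by exists (fun=> 0); rewrite big1 // => l _; rewrite mul0r.
- move=> _ _ [c ->] [c' ->]; exists (fun l => c l + c' l).
  by rewrite -big_split; apply: eq_bigr => l _; rewrite mulrDl.
- move=> r _ [c ->]; exists (fun l => r * c l).
  by rewrite mulr_sumr; apply: eq_bigr => l _; rewrite mulrA.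
Qed.

Lemma is_ideal_ker (R T : comNzRingType) (f : {rmorphism R -> T}) :
  is_ideal (fun x => f x = 0).
Proof.
split=> [|a b a0 b0|r a a0]; first by rewrite rmorph0.
  by rewrite rmorphD a0 b0 addr0.
by rewrite rmorphM a0 mulr0.
Qed.

Lemma mem_gen_ideal (R : comNzRingType) (s : seq R) x :
  x \in s -> gen_ideal s x.
Proof.
move=> xs; exists (fun i => (i == index x s)%:R).
have ltx : (index x s < size s)%N by rewrite index_mem.
rewrite (bigD1 (Ordinal ltx)) //= eqxx mul1r nth_index // big1 ?addr0 // => i.
by rewrite -val_eqE /= => /negPf ->; rewrite mul0r.
Qed.

Lemma gen_ideal_ker (R T : comNzRingType) (f : {rmorphism R -> T}) (s : seq R) :
  (forall x, x \in s -> f x = 0) -> forall x, gen_ideal s x -> f x = 0.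
Proof.
move=> fs _ [c ->]; rewrite rmorph_sum big1 // => i _.
by rewrite rmorphM (fs s`_i) ?mulr0 // mem_nth.
Qed.

(* The algebra B0[Y_1, ..., Y_k] / (r); T, h and t witness that it is not 0. *)
Lemma adjoin (A : comNzRingType) (B0 : comAlgType A) (k : nat)
    (r : seq (mpoly k B0)) (T : comNzRingType) (h : {rmorphism B0 -> T})
    (t : 'I_k -> T) :
  finitely_presented B0 -> (forall P, P \in r -> mmap h t P = 0) ->
  exists (B1 : comAlgType A) (i : {lrmorphism B0 -> B1}) (y : 'I_k -> B1),
  [/\ finitely_presented B1, forall P, P \in r -> mmap i y P = 0,
      forall b, exists P, b = mmap i y P
    & forall (T : comNzRingType) (h : {rmorphism B0 -> T}) (t : 'I_k -> T),
      (forall P, P \in r -> mmap h t P = 0) ->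
      exists h' : {rmorphism B1 -> T},
        (forall b, h' (i b) = h b) /\ forall j, h' (y j) = t j].
Proof.
move=> [n0 [phi [s [phiS kerphi]]]] ht.
pose M := mpoly (n0 + k) A.
pose cst : {rmorphism A -> mpoly k B0} := (@mpolyC k B0 \o GRing.in_alg B0)%FUN.
(* In the presentation of B1 over A, the first [n0] variables stand for the generators of B0 and the
   last [k] for the Y_j; the relations are those of B0 and lifts of those in [r]. *)
have [ev [_ evC evX]] := mmap_rmorphism cst (fun i : 'I_(n0 + k) =>
  match fintype.split i with inl a => mpolyC k (phi (mvar a)) | inr b => mvar b end).
have [emb [_ embC embX]] := mmap_rmorphism (@mpolyC (n0 + k) A)
  (fun i : 'I_n0 => mvar (lshift k i)).
have evl i : ev (mvar (lshift k i)) = mpolyC k (phi (mvar i)).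
  by rewrite evX (unsplitK (inl i)).
have evr i : ev (mvar (rshift n0 i)) = mvar i by rewrite evX (unsplitK (inr i)).
have phiC a : phi (mpolyC n0 a) = a%:A.
  by rewrite -(mulr1 (mpolyC n0 a)) mul_mpolyC linearZ /= rmorph1.
have evemb P : ev (emb P) = mpolyC k (phi P).
  move: P; apply: (@mpoly_rmorphism_ext _ _ _ (ev \o emb)%FUN
    (@mpolyC k B0 \o phi)%FUN) => [c|i] /=; first by rewrite embC evC phiC.
  by rewrite embX evl.
have evS P : exists w, ev w = P.
  move: P; apply: mpoly_closed_ind => [c|i|_ _ [x <-] [y <-]|_ _ [x <-] [y <-]].
  - by have [P <-] := phiS c; exists (emb P); rewrite evemb.
  - by exists (mvar (rshift n0 i)).
  - by exists (x + y); rewrite rmorphD.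
  - by exists (x * y); rewrite rmorphM.
have [lft lftK] := choice evS.
have phis x : x \in s -> phi x = 0 by move=> xs; apply/kerphi/mem_gen_ideal.
pose rel := map emb s ++ map lft r.
have mem_rel w : w \in rel ->
    (exists2 x, x \in s & w = emb x) \/ (exists2 P, P \in r & w = lft P).
  by rewrite mem_cat => /orP[] /mapP[x xs ->]; [left|right]; exists x.
have lift (T' : comNzRingType) (f : {rmorphism B0 -> T'}) (u : 'I_k -> T') :
    (forall P, P \in r -> mmap f u P = 0) ->
    exists F : {rmorphism mpoly k B0 -> T'},
      [/\ forall b, F (mpolyC k b) = f b, forall j, F (mvar j) = u j &
          forall w, gen_ideal rel w -> F (ev w) = 0].
  move=> fu; have [F [FE FC FX]] := mmap_rmorphism f u; exists F; split=> //.
  apply: (gen_ideal_ker (f := (F \o ev)%FUN)) => w /mem_rel[[x xs ->]|[P Pr ->]] /=.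
    by rewrite evemb phis // mpolyC0 rmorph0.
  by rewrite lftK FE fu.
have properI : ~ gen_ideal rel 1.
  have [F [_ _ Frel]] := lift _ _ _ ht.
  by move/Frel/eqP; rewrite !rmorph1 oner_eq0.
have [Q0 [q0 [q0S kerq0]]] := quotient_exists (is_ideal_gen rel) properI.
have [Q [jQ [[jQ' jQK jQ'K] jQA]]] := algebra_exists (q0 \o @mpolyC (n0 + k) A)%FUN.
have [q qE] : exists q : {lrmorphism M -> Q}, q =1 (jQ \o q0)%FUN.
  by apply: lrmorphism_of => a; rewrite -jQA /= -mul_mpolyC mulr1.
have qS : Defs.surjective q.
  by move=> y; have [x xy] := q0S (jQ' y); exists x; rewrite qE /= xy.
have kerq w : q w = 0 <-> gen_ideal rel w.
  rewrite qE -kerq0; split=> [|/= ->]; last by rewrite rmorph0.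
  by move=> qw; rewrite -(jQK (q0 w)) [jQ _]qw -[RHS](jQK 0) rmorph0.
have qA a : q (mpolyC (n0 + k) a) = a%:A by rewrite qE; apply: jQA.
have relq w : w \in rel -> q w = 0 by move/mem_gen_ideal/kerq.
have [i0 i0E] : exists i : {rmorphism B0 -> Q}, forall P, i (phi P) = q (emb P).
  apply: (factor_rmorphism (h := (q \o emb)%FUN)) => // P /kerphi.
  apply: (gen_ideal_ker (f := (q \o emb)%FUN)) => x xs.
  by apply: relq; rewrite mem_cat map_f.
have [i iE] : exists i : {lrmorphism B0 -> Q}, i =1 i0.
  by apply: lrmorphism_of => a; rewrite -phiC i0E embC qA.
pose y j := q (mvar (rshift n0 j)).
have [G [GE GC GX]] := mmap_rmorphism i y.
have Gev w : G (ev w) = q w.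
  move: w; apply: (@mpoly_rmorphism_ext _ _ _ (G \o ev)%FUN) => [a|j] /=.
    by rewrite evC GC /= linearZ /= rmorph1 qA.
  rewrite -(splitK j); case: (fintype.split j) => l /=; last by rewrite evr GX.
  by rewrite evl GC; apply: etrans (iE _) _; rewrite i0E embX.
exists Q, i, y; split.
- exists (n0 + k)%N, q, rel; split=> // w; exact: kerq.
- move=> P Pr; rewrite -GE -[P]lftK Gev; apply: relq.
  by rewrite mem_cat orbC map_f.
- by move=> b; have [w <-] := qS b; exists (ev w); rewrite -GE Gev.
- move=> T' f u /lift[F [FC FX Frel]].
  have [h' h'E] : exists h' : {rmorphism Q -> T'}, forall w, h' (q w) = F (ev w).
    by apply: (factor_rmorphism (h := (F \o ev)%FUN)) => // w /kerq/Frel.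
  exists h'; split=> [b|j]; last by rewrite h'E evr FX.
  by have [P <-] := phiS b; rewrite iE i0E h'E evemb FC.
Qed.

Lemma mmap_ext (k : nat) (R B T : comNzRingType) (i : {rmorphism R -> B})
    (y : 'I_k -> B) (f g : {rmorphism B -> T}) :
  (forall b, exists P, b = mmap i y P) ->
  (forall b, f (i b) = g (i b)) -> (forall j, f (y j) = g (y j)) -> f =1 g.
Proof.
move=> gen ei ey b; have [P ->] := gen b.
have [F [FE FC FX]] := mmap_rmorphism i y; rewrite -FE; move: P.
apply: (@mpoly_rmorphism_ext _ _ _ (f \o F)%FUN (g \o F)%FUN) => [c|j] /=.
  by rewrite FC ei.
by rewrite FX ey.
Qed.

(** The B0-span of the [w l] contains 1 and is stable under multiplication by the algebra generators
    [y j], hence is all of B1. *)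
Lemma finite_module_trans (A : comNzRingType) (B0 B1 : comAlgType A) (k r : nat)
    (i : {lrmorphism B0 -> B1}) (y : 'I_k -> B1) (w : 'I_r -> B1) :
  finite_module B0 -> (forall b, exists P, b = mmap i y P) ->
  (exists c : 'I_r -> B0, 1 = \sum_l i (c l) * w l) ->
  (forall l j, exists c : 'I_r -> B0, w l * y j = \sum_l i (c l) * w l) ->
  finite_module B1.
Proof.
move=> [s sP] gen [c1 c1E] wy.
pose sp (v : B1) := exists c : 'I_r -> B0, v = \sum_l i (c l) * w l.
have spD u v : sp u -> sp v -> sp (u + v).
  move=> [c ->] [c' ->]; exists (fun l => c l + c' l).
  by rewrite -big_split; apply: eq_bigr => l _; rewrite rmorphD mulrDl.
have spZ b v : sp v -> sp (i b * v).
  move=> [c ->]; exists (fun l => b * c l).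
  by rewrite mulr_sumr; apply: eq_bigr => l _; rewrite rmorphM mulrA.
have sp0 : sp 0 by exists (fun=> 0); rewrite big1 // => l _; rewrite rmorph0 mul0r.
have spy v j : sp v -> sp (v * y j).
  move=> [c ->]; rewrite mulr_suml; apply: (big_ind sp) => // l _.
  by rewrite -mulrA; apply/spZ/wy.
have spall b : sp b.
  have [P ->] := gen b; have [F [FE FC FX]] := mmap_rmorphism i y; rewrite -FE.
  suff H v : sp v -> sp (v * F P) by rewrite -[F P]mul1r; apply: H; exists c1.
  move: P v; apply: mpoly_closed_ind => [c|j|P P' HP HP'|P P' HP HP'] v spv.
  - by rewrite FC mulrC; apply: spZ.
  - by rewrite FX; apply: spy.
  - by rewrite rmorphD mulrDr; apply: spD; [apply: HP|apply: HP'].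
  - by rewrite rmorphM mulrA; apply/HP'/HP.
pose w' := [tuple w l | l < r].
pose t := [seq i b * v | b <- s, v <- w'].
pose spA (v : B1) := exists c : nat -> A, v = \sum_(l < size t) c l *: t`_l.
have spAD u v : spA u -> spA v -> spA (u + v).
  move=> [c ->] [c' ->]; exists (fun l => c l + c' l).
  by rewrite -big_split; apply: eq_bigr => l _; rewrite scalerDl.
have spAZ a v : spA v -> spA (a *: v).
  move=> [c ->]; exists (fun l => a * c l).
  by rewrite scaler_sumr; apply: eq_bigr => l _; rewrite scalerA.
have spA0 : spA 0 by exists (fun=> 0); rewrite big1 // => l _; rewrite scale0r.
have spAt v : v \in t -> spA v.
  move=> vt; exists (fun l => (l == index v t)%:R).
  have ltv : (index v t < size t)%N by rewrite index_mem.
  rewrite (bigD1 (Ordinal ltv)) //= eqxx scale1r nth_index // big1 ?addr0 // => l.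
  by rewrite -val_eqE /= => /negPf ->; rewrite scale0r.
exists t => b; suff: spA b by [].
have [c ->] := spall b; apply: (big_ind spA) => // l _.
have [a ->] := sP (c l); rewrite linear_sum mulr_suml; apply: (big_ind spA) => // u _.
rewrite linearZ -scalerAl; apply/spAZ/spAt/allpairs_f; first exact: mem_nth.
by rewrite -(tnth_mktuple w l) mem_tnth.
Qed.

(** * Finite étale algebras *)

Lemma pairing_rmorph (C : comNzRingType) (m : nat) (x y : 'I_m -> C)
    (S T : comNzRingType) (h : {rmorphism S -> T}) (f g : C -> S) :
  h (pairing x y f g) = pairing x y (h \o f)%FUN (h \o g)%FUN.
Proof. by rewrite rmorph_sum; apply: eq_bigr => l _; rewrite rmorphM. Qed.

Lemma eq_pairing (C : comNzRingType) (m : nat) (x y : 'I_m -> C)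
    (T : comNzRingType) (f f' g g' : C -> T) :
  f =1 f' -> g =1 g' -> pairing x y f g = pairing x y f' g'.
Proof. by move=> ef eg; apply: eq_bigr => l _; rewrite ef eg. Qed.

Section Pairing.
Variables (A : comNzRingType) (C : comAlgType A) (m : nat) (x y : 'I_m -> C).
Hypothesis sepxy : separating x y.
Variables (T : comNzRingType) (f g : {rmorphism C -> T}).
Hypothesis fgA : forall a : A, f a%:A = g a%:A.

Lemma pairing_diag (h : {rmorphism C -> T}) : pairing x y h h = 1.
Proof.
rewrite -(rmorph1 h) -sepxy.1 rmorph_sum.
by apply: eq_bigr => l _; rewrite rmorphM.
Qed.

(** In the presence of one factor [pairing x y f g], [f] may be replaced by [g] in the other, which
    becomes [pairing x y g g = 1]. *)
Lemma pairing_idem : pairing x y f g * pairing x y f g = pairing x y f g.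
Proof.
rewrite {2}/pairing mulr_sumr -[RHS]mulr1 -(pairing_diag g) mulr_sumr.
by apply: eq_bigr => l _; rewrite !mulrA sepxy.2.
Qed.

Lemma pairing_sym0 : pairing x y f g = 0 -> pairing x y g f = 0.
Proof.
move=> fg0; suff : pairing x y g f * pairing x y f g = pairing x y g f.
  by rewrite fg0 mulr0.
rewrite {2}/pairing mulr_sumr -[RHS]mulr1 -(pairing_diag g) mulr_sumr.
by apply: eq_bigr => l _; rewrite !mulrA sepxy.2.
Qed.

End Pairing.

Lemma pairing_field (A : comNzRingType) (C : comAlgType A) (m : nat)
    (x y : 'I_m -> C) (K : fieldType) (f g : {rmorphism C -> K}) :
  separating x y -> (forall a : A, f a%:A = g a%:A) -> ~ f =1 g ->
  pairing x y f g = 0.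
Proof.
move=> sepxy fgA fg; apply/eqP; apply: contra_notT fg => P0 c.
exact: (mulfI P0 (sepxy.2 _ _ _ fgA c)).
Qed.

Lemma exprD_pchar (R : comNzRingType) (p : nat) (a b : R) :
  p \in [pchar R] -> (a + b) ^+ p = a ^+ p + b ^+ p.
Proof. by move=> pR; apply: (rmorphD (pFrobenius_aut pR)). Qed.

Lemma exprB_pchar (R : comNzRingType) (p : nat) (a b : R) :
  p \in [pchar R] -> (a - b) ^+ p = a ^+ p - b ^+ p.
Proof. by move=> pR; apply: (rmorphB (pFrobenius_aut pR)). Qed.

(** The pair [h], [t] is a point of the covering and shows it to be nonempty. The last two clauses
    are the universal property of B0[Y] / (Y^p - Y - f), and 1, y, ..., y^(p-1) span it. *)
Lemma artin_schreier (A : comNzRingType) (p : nat) (pA : p \in [pchar A])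
    (B0 : finite_etale A) (f : B0)
    (T : comNzRingType) (h : {rmorphism B0 -> T}) (t : T) :
  t ^+ p - t = h f ->
  exists (B1 : finite_etale A) (i : {lrmorphism B0 -> B1}) (y : B1),
  [/\ y ^+ p - y = i f,
      forall (T : comNzRingType) (g g' : {rmorphism B1 -> T}),
        (forall b, g (i b) = g' (i b)) -> g y = g' y -> g =1 g'
    & forall (T : comNzRingType) (h : {rmorphism B0 -> T}) (t : T),
      t ^+ p - t = h f ->
      exists h' : {rmorphism B1 -> T}, (forall b, h' (i b) = h b) /\ h' y = t].
Proof.
have p_prime := pcharf_prime pA.
have [B0_fp B0_fe] := fet_etale B0.
pose P : mpoly 1 B0 := mvar 0 ^+ p - mvar 0 - mpolyC 1 f.
have PE (T' : comNzRingType) (g : {rmorphism B0 -> T'}) (u : 'I_1 -> T') :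
    (forall Q, Q \in [:: P] -> mmap g u Q = 0) <-> u 0 ^+ p - u 0 = g f.
  have [F [FE FC FX]] := mmap_rmorphism g u.
  have FP : F P = u 0 ^+ p - u 0 - g f by rewrite !rmorphB rmorphXn FX FC.
  split=> [H|eP Q]; first by apply/eqP; rewrite -subr_eq0 -FP FE H ?inE.
  by rewrite inE => /eqP ->; rewrite -FE FP eP subrr.
move=> /(PE _ h (fun=> t)) ht.
have [B1 [i [Y [B1_fp B1r gen univ]]]] := adjoin B0_fp ht.
pose y := Y 0.
have yE : y ^+ p - y = i f by apply/PE.
have ext (T' : comNzRingType) (g g' : {rmorphism B1 -> T'}) :
    (forall b, g (i b) = g' (i b)) -> g y = g' y -> g =1 g'.
  by move=> ei ey; apply: (mmap_ext gen) => // l; rewrite ord1.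
have {}univ (T' : comNzRingType) (g : {rmorphism B0 -> T'}) (u : T') :
      u ^+ p - u = g f ->
      exists h' : {rmorphism B1 -> T'}, (forall b, h' (i b) = g b) /\ h' y = u.
  by move=> /(PE _ g (fun=> u)) /univ[h' [h'i h'Y]]; exists h'; split=> //; apply: h'Y.
have p_gt1 := prime_gt1 p_prime.
have B1_fin : finite_module B1.
  have sumE e b : (e < p)%N ->
      \sum_(l < p) i ((l == e :> nat)%:R * b) * y ^+ l = i b * y ^+ e.
    move=> lte; rewrite (bigD1 (Ordinal lte)) //= eqxx mul1r big1 ?addr0 // => l.
    by rewrite -val_eqE /= => /negPf ->; rewrite mul0r rmorph0 mul0r.
  apply: (finite_module_trans (w := fun l : 'I_p => y ^+ l) (fet_finite B0) gen).
    exists (fun l => (l == 0 :> nat)%:R * 1).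
    by rewrite (sumE 0%N 1) ?prime_gt0 // rmorph1 mulr1.
  move=> l l0; rewrite ord1 -/y -exprSr; have [lt1|] := ltnP l.+1 p.
    exists (fun l' => (l' == l.+1 :> nat)%:R * 1).
    by rewrite (sumE l.+1 1) // rmorph1 mul1r.
  move=> gep; have -> : l.+1 = p by apply/eqP; rewrite eqn_leq gep ltn_ord.
  exists (fun l' => (l' == 0 :> nat)%:R * f + (l' == 1 :> nat)%:R * 1).
  under eq_bigr => l' _ do rewrite rmorphD mulrDl.
  rewrite big_split /= (sumE 0%N f) ?prime_gt0 // (sumE 1%N 1) //.
  by rewrite rmorph1 mul1r mulr1 -yE subrK.
suff B1_fe : formally_etale B1.
  by exists (FiniteEtale B1_fin (conj B1_fp B1_fe)), i, y.
move=> C D q qsq u.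
have pC : p \in [pchar C] by apply: (rmorph_pchar (GRing.in_alg C)).
have [v0 v0E v0_uniq] := B0_fe C D q qsq (u \o i)%FUN.
have [qS q2] := qsq.
have [c qc] := qS (u y).
(* One step of Newton's method: the derivative of Y^p - Y is -1, so the correction to the
   approximate root [c] is [d] itself. It is exact since [d ^+ p = 0]. *)
pose d := c ^+ p - c - v0 f.
have qd : q d = 0.
  rewrite !rmorphB rmorphXn /= v0E /= qc -yE rmorphB rmorphXn.
  by rewrite subrr.
have expp e : q e = 0 -> e ^+ p = 0.
  by move=> qe; rewrite -(subnK p_gt1) exprD expr2 (q2 e e) // mulr0.
have [v' [v'i v'y]] : exists h' : {rmorphism B1 -> C},
    (forall b, h' (i b) = v0 b) /\ h' y = c + d.
  apply: univ; rewrite exprD_pchar // (expp d) // addr0 opprD addrA.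
  by rewrite /d opprB addrC subrK.
have [v vE] : exists v : {lrmorphism B1 -> C}, v =1 v'.
  apply: lrmorphism_of => a; have := v'i a%:A.
  by rewrite !linearZ /= !rmorph1.
exists v.
  apply: (ext _ (q \o v)%FUN) => [b|] /=; rewrite vE ?v'i ?v0E //.
  by rewrite v'y rmorphD /= qc qd addr0.
move=> w wE; have wi : (w \o i)%FUN =1 v0 by apply: v0_uniq => b; apply: wE.
apply: ext => [b|] /=; first by rewrite vE v'i -wi.
rewrite vE v'y; apply/eqP; rewrite -subr_eq0; apply/eqP.
(* The difference of two roots is equal to its own p-th power, which is 0 as the difference lies in
   the square-zero kernel. *)
have qe : q (w y - (c + d)) = 0 by rewrite rmorphB /= wE rmorphD /= qc qd addr0 subrr.
have := expp _ qe; rewrite exprB_pchar // => e0.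
have wp : w y ^+ p = w y + v0 f.
  by apply/eqP; rewrite addrC -subr_eq -rmorphXn -rmorphB yE -wi.
have cp : (c + d) ^+ p = c + d + v0 f.
  by rewrite -v'y; apply/eqP; rewrite addrC -subr_eq -rmorphXn -rmorphB yE v'i.
by rewrite -[RHS]e0 wp cp [in RHS]opprD [RHS]addrACA subrr addr0.
Qed.

Lemma unlift_max n (j : 'I_n.+1) :
  (exists k, j = lift ord_max k) \/ j = ord_max.
Proof. by case: (unliftP ord_max j) => [k|]; [left; exists k|right]. Qed.

(** One equation at a time; the point [t] is carried along, since each step needs a point of the
    next covering. *)
Lemma artin_schreier_multi (A : comNzRingType) (p : nat) (pA : p \in [pchar A])
    (B0 : finite_etale A) (m : nat) (f : 'I_m -> B0)
    (T : comNzRingType) (h : {rmorphism B0 -> T}) (t : 'I_m -> T) :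
  (forall j, t j ^+ p - t j = h (f j)) ->
  exists (B1 : finite_etale A) (i : {lrmorphism B0 -> B1}) (y : 'I_m -> B1),
  [/\ forall j, y j ^+ p - y j = i (f j),
      forall (T : comNzRingType) (g g' : {rmorphism B1 -> T}),
        (forall b, g (i b) = g' (i b)) -> (forall j, g (y j) = g' (y j)) ->
        g =1 g'
    & forall (T : comNzRingType) (h : {rmorphism B0 -> T}) (t : 'I_m -> T),
      (forall j, t j ^+ p - t j = h (f j)) ->
      exists h' : {rmorphism B1 -> T},
        (forall b, h' (i b) = h b) /\ forall j, h' (y j) = t j].
Proof.
elim: m f t => [|m IHm] f t ht.
  exists B0, (idfun : {lrmorphism B0 -> B0}), (fun=> 0).
  split=> [[]|T' g g' + _|T' h' u _] //.
  by exists h'; split=> // -[].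
have [B1 [i1 [y1 [y1E ext1 univ1]]]] :=
  IHm (f \o lift ord_max) (t \o lift ord_max) (fun j => ht (lift ord_max j)).
have [h1 [h1i h1y]] := univ1 _ _ _ (fun j => ht (lift ord_max j)).
have ht1 : t ord_max ^+ p - t ord_max = h1 (i1 (f ord_max)) by rewrite h1i.
have [B2 [i2 [y2 [y2E ext2 univ2]]]] := artin_schreier pA ht1.
pose y j := if unlift ord_max j is Some k then i2 (y1 k) else y2.
have yl k : y (lift ord_max k) = i2 (y1 k) by rewrite /y liftK.
have ym : y ord_max = y2 by rewrite /y unlift_none.
exists B2, (i2 \o i1)%FUN, y; split.
- move=> j; case: (unlift_max j) => [[k ->]| ->] /=; last by rewrite ym.
  by rewrite yl -rmorphXn -rmorphB y1E.
- move=> T' g g' ei ey; apply: ext2 => [b|]; last by rewrite -ym.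
  move: b; apply: (ext1 _ (g \o i2)%FUN (g' \o i2)%FUN) => [b|j] /=; first exact: ei.
  by rewrite -yl.
- move=> T' h' u hu; have [h1' [h1'i h1'y]] := univ1 _ _ _ (fun j => hu (lift ord_max j)).
  have hu1 : u ord_max ^+ p - u ord_max = h1' (i1 (f ord_max)) by rewrite h1'i.
  have [h2 [h2i h2y]] := univ2 _ _ _ hu1.
  exists h2; split=> [b|j] /=; first by rewrite h2i.
  case: (unlift_max j) => [[k ->]| ->]; last by rewrite ym.
  by rewrite yl h2i h1'y.
Qed.

(* B0 (x) C, cut down to the locus where the new map from C is everywhere
   distinct from the maps js. *)
Lemma adjoin_point (A : comNzRingType) (B0 C : finite_etale A) (m : nat)
    (x y : 'I_m -> C) (sepxy : separating x y)
    (n : nat) (js : 'I_n -> {lrmorphism C -> B0})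
    (T : comNzRingType) (h : {rmorphism B0 -> T}) (k : {rmorphism C -> T}) :
  (forall a : A, h a%:A = k a%:A) ->
  (forall l, pairing x y (h \o js l)%FUN k = 0) ->
  exists (B1 : finite_etale A) (i : {lrmorphism B0 -> B1})
         (z : {lrmorphism C -> B1}),
  [/\ forall l, pairing x y (i \o js l)%FUN z = 0,
      forall (T : comNzRingType) (g g' : {rmorphism B1 -> T}),
        (forall b, g (i b) = g' (i b)) -> (forall c, g (z c) = g' (z c)) ->
        g =1 g'
    & forall (T : comNzRingType) (h : {rmorphism B0 -> T}) (k : {rmorphism C -> T}),
      (forall a : A, h a%:A = k a%:A) ->
      (forall l, pairing x y (h \o js l)%FUN k = 0) ->
      exists h' : {rmorphism B1 -> T},
        (forall b, h' (i b) = h b) /\ forall c, h' (z c) = k c].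
Proof.
have [B0_fp B0_fe] := fet_etale B0.
have [[d [phi [s [phiS kerphi]]]] C_fe] := fet_etale C.
have phiC a : phi (mpolyC d a) = a%:A.
  by rewrite -(mulr1 (mpolyC d a)) mul_mpolyC linearZ /= rmorph1.
pose cst : {rmorphism A -> mpoly d B0} := (@mpolyC d B0 \o GRing.in_alg B0)%FUN.
have [emb [_ embC embX]] := mmap_rmorphism cst (fun i : 'I_d => mvar i).
have [lft lftK] := choice phiS.
have phis P : P \in s -> phi P = 0 by move=> Ps; apply/kerphi/mem_gen_ideal.
(* The polynomial whose value at a pair of points is their pairing: setting it to 0 removes the open
   and closed locus where the new map agrees with [js l]. *)
pose dis l := \sum_e mpolyC d (js l (x e)) * emb (lft (y e)).
pose r := map emb s ++ [seq dis l | l : 'I_n].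
have rE (T' : comNzRingType) (h' : {rmorphism B0 -> T'}) (k' : {rmorphism C -> T'}) :
    (forall a : A, h' a%:A = k' a%:A) ->
    exists F : {rmorphism mpoly d B0 -> T'},
    [/\ F =1 mmap h' (fun i => k' (phi (mvar i))), forall P, F (emb P) = k' (phi P),
        forall b, F (mpolyC d b) = h' b &
        forall l, F (dis l) = pairing x y (h' \o js l)%FUN k'].
  move=> hk; have [F [FE FC FX]] := mmap_rmorphism h' (fun i => k' (phi (mvar i))).
  have Femb P : F (emb P) = k' (phi P).
    move: P; apply: (@mpoly_rmorphism_ext _ _ _ (F \o emb)%FUN (k' \o phi)%FUN) => [c|i] /=.
      by rewrite embC FC phiC hk.
    by rewrite embX FX.
  exists F; split=> // l; rewrite rmorph_sum; apply: eq_bigr => e _.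
  by rewrite rmorphM FC Femb lftK.
have rk (T' : comNzRingType) (h' : {rmorphism B0 -> T'}) (k' : {rmorphism C -> T'}) :
    (forall a : A, h' a%:A = k' a%:A) ->
    (forall l, pairing x y (h' \o js l)%FUN k' = 0) ->
    forall P, P \in r -> mmap h' (fun i => k' (phi (mvar i))) P = 0.
  move=> hk hj P; have [F [FE Femb _ Fdis]] := rE _ _ _ hk; rewrite -FE.
  rewrite mem_cat => /orP[/mapP[P' P's ->]|/mapP[l _ ->]].
    by rewrite Femb phis // rmorph0.
  by rewrite Fdis.
move=> hk hj; have [B1 [i [Y [B1_fp B1r gen univ]]]] := adjoin B0_fp (rk _ _ _ hk hj).
have iA a : i a%:A = a%:A by rewrite linearZ /= rmorph1.
have [G [GE GC GX]] := mmap_rmorphism i Y.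
have [z0 z0E] : exists z : {rmorphism C -> B1}, forall P, z (phi P) = G (emb P).
  apply: (factor_rmorphism (h := (G \o emb)%FUN)) => // P /kerphi.
  apply: (gen_ideal_ker (f := (G \o emb)%FUN)) => Q Qs /=.
  by rewrite GE B1r // mem_cat map_f.
have [z zE] : exists z : {lrmorphism C -> B1}, z =1 z0.
  by apply: lrmorphism_of => a; rewrite -phiC z0E embC GC /= iA.
have zA (a : A) : z a%:A = a%:A by rewrite linearZ /= rmorph1.
have zX j : z (phi (mvar j)) = Y j by rewrite zE z0E embX GX.
have zdis l : pairing x y (i \o js l)%FUN z = 0.
  have <- : G (dis l) = pairing x y (i \o js l)%FUN z.
    rewrite rmorph_sum; apply: eq_bigr => e _.
    by rewrite rmorphM GC -z0E -zE lftK.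
  by rewrite GE B1r // mem_cat (map_f dis) ?mem_enum ?orbT.
have ext (T' : comNzRingType) (g g' : {rmorphism B1 -> T'}) :
    (forall b, g (i b) = g' (i b)) -> (forall c, g (z c) = g' (z c)) -> g =1 g'.
  by move=> ei ez; apply: (mmap_ext gen) => // j; rewrite -zX.
have {}univ (T' : comNzRingType) (h' : {rmorphism B0 -> T'}) (k' : {rmorphism C -> T'}) :
    (forall a : A, h' a%:A = k' a%:A) ->
    (forall l, pairing x y (h' \o js l)%FUN k' = 0) ->
    exists g : {rmorphism B1 -> T'},
      (forall b, g (i b) = h' b) /\ forall c, g (z c) = k' c.
  move=> hk' /(rk _ _ _ hk')/univ[g [gi gY]]; exists g; split=> // c.
  have [P <-] := phiS c; move: P.
  apply: (@mpoly_rmorphism_ext _ _ _ (g \o z \o phi)%FUN (k' \o phi)%FUN) => [a|j] /=.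
    by rewrite phiC zA -iA gi hk'.
  by rewrite zX gY.
have B1_fin : finite_module B1.
  have [t tP] := fet_finite C.
  apply: (finite_module_trans (w := fun l : 'I_(size t) => z t`_l) (fet_finite B0) gen).
    have [c c1] := tP 1; exists (fun l => (c l)%:A).
    rewrite -(rmorph1 z) c1 rmorph_sum; apply: eq_bigr => l _ /=.
    by rewrite linearZ /= iA mulr_algl.
  move=> l j; have [c c1] := tP (t`_l * phi (mvar j)); exists (fun l => (c l)%:A).
  rewrite -zX -rmorphM c1 rmorph_sum; apply: eq_bigr => e _ /=.
  by rewrite linearZ /= iA mulr_algl.
suff B1_fe : formally_etale B1.
  by exists (FiniteEtale B1_fin (conj B1_fp B1_fe)), i, z.
move=> R D q qsq u.
have [v0 v0E v0_uniq] := B0_fe R D q qsq (u \o i)%FUN.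
have [v1 v1E v1_uniq] := C_fe R D q qsq (u \o z)%FUN.
have [qS q2] := qsq.
have v01 (a : A) : v0 a%:A = v1 a%:A by rewrite !linearZ /= !rmorph1.
(* An idempotent in a square-zero ideal is 0, so the disjointness of the lifts follows from that of
   their reductions. *)
have vdis l : pairing x y (v0 \o js l)%FUN v1 = 0.
  have vA (a : A) : (v0 \o js l)%FUN a%:A = v1 a%:A.
    by rewrite /= linearZ /= rmorph1 v01.
  rewrite -(pairing_idem sepxy vA) q2 // pairing_rmorph.
    rewrite -(rmorph0 u) -(zdis l) pairing_rmorph.
    by apply: eq_pairing => c /=; [apply: v0E|apply: v1E].
  rewrite -(rmorph0 u) -(zdis l) pairing_rmorph.
  by apply: eq_pairing => c /=; [apply: v0E|apply: v1E].
have [v' [v'i v'z]] := univ _ _ _ v01 vdis.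
have [v vE] : exists v : {lrmorphism B1 -> R}, v =1 v'.
  by apply: lrmorphism_of => a; rewrite -iA v'i /= linearZ /= rmorph1.
exists v.
  by apply: (ext _ (q \o v)%FUN) => b /=; rewrite vE ?v'i ?v'z ?v0E ?v1E.
move=> w wE.
have wi : (fun b => w (i b)) =1 v0 by apply: (v0_uniq (w \o i)%FUN) => b; apply: wE.
have wz : (fun b => w (z b)) =1 v1 by apply: (v1_uniq (w \o z)%FUN) => b; apply: wE.
by apply: ext => b /=; rewrite vE ?v'i ?v'z /= -?wi -?wz.
Qed.

Lemma trivial_etale (A : comNzRingType) : finite_module A^o /\ etale_algebra A^o.
Proof.
split.
  by exists [:: 1] => a; exists (fun=> a); rewrite big_ord1 /= /GRing.scale /= mulr1.
split.
  pose v0 : 'I_0 -> A := fun=> 0.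
  have [ev [_ evC _]] := mmap_rmorphism (idfun : {rmorphism A -> A}) v0.
  have [phi phiE] : exists phi : {lrmorphism mpoly 0 A -> A^o}, phi =1 ev.
    apply: (@lrmorphism_of A (mpoly 0 A) A^o ev) => a.
    by rewrite -mul_mpolyC mulr1 evC /GRing.scale /= mulr1.
  have evK P : mpolyC 0 (ev P) = P.
    move: P; apply: (@mpoly_rmorphism_ext _ _ _ (@mpolyC 0 A \o ev)%FUN idfun) => [c|[]//].
    by rewrite /= evC.
  exists 0, phi, [::]; split=> [a|P]; first by exists (mpolyC 0 a); rewrite phiE evC.
  rewrite phiE; split=> [P0|[c ->]]; last by rewrite big_ord0 rmorph0.
  by exists (fun=> 0); rewrite big_ord0 -[P]evK P0 mpolyC0.
move=> C D q qsq u.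
have [v vE] : exists v : {lrmorphism A^o -> C}, v =1 GRing.in_alg C.
  by apply: (@lrmorphism_of A A^o C (GRing.in_alg C)) => a /=; rewrite /GRing.scale /= mulr1.
have AE (a : A^o) : a = (a : A) *: (1 : A^o) by rewrite /GRing.scale /= mulr1.
exists v => [a|v' _ a].
  by rewrite vE /= linearZ /= rmorph1 [in RHS](AE a) linearZ /= rmorph1.
by rewrite (AE a) !linearZ /= !rmorph1.
Qed.

Section Closure.
Variables (A : comNzRingType) (C : finite_etale A) (m : nat).
Variables (x y : 'I_m -> C).
Hypothesis sepxy : separating x y.

(* The n-fold product of Spec C over Spec A, without its diagonals. *)
Lemma configuration_algebra (n : nat) (T : comNzRingType) (h0 : {rmorphism A -> T})
    (f : 'I_n -> {rmorphism C -> T}) :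
  (forall l (a : A), f l a%:A = h0 a) ->
  (forall l l', l != l' -> pairing x y (f l) (f l') = 0) ->
  exists (B : finite_etale A) (i : 'I_n -> {lrmorphism C -> B}),
  [/\ forall l l', l != l' -> pairing x y (i l) (i l') = 0,
      forall (T : comNzRingType) (g g' : {rmorphism B -> T}),
        (forall a : A, g a%:A = g' a%:A) -> (forall l c, g (i l c) = g' (i l c)) ->
        g =1 g'
    & forall (T : comNzRingType) (h0 : {rmorphism A -> T})
        (f : 'I_n -> {rmorphism C -> T}),
      (forall l (a : A), f l a%:A = h0 a) ->
      (forall l l', l != l' -> pairing x y (f l) (f l') = 0) ->
      exists h : {rmorphism B -> T},
        (forall a, h a%:A = h0 a) /\ forall l c, h (i l c) = f l c].
Proof.
elim: n f => [|n IHn] f fA fdis.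
  have [A_fin A_et] := trivial_etale A.
  exists (FiniteEtale A_fin A_et).
  have i0 : 'I_0 -> {lrmorphism C -> A^o} by case.
  exists i0; split=> [[]//|T' g g' gA _ a|T' h f' _ _].
    by have := gA a; rewrite /GRing.scale /= mulr1.
  by exists h; split=> [a|[]//]; rewrite /GRing.scale /= mulr1.
have [|B0 [i0 [i0dis ext0 univ0]]] :=
  IHn (fun l => f (lift ord_max l)) (fun l => fA (lift ord_max l)).
  by move=> l l' ll'; apply: fdis; rewrite (inj_eq lift_inj).
have step (T' : comNzRingType) (h0' : {rmorphism A -> T'})
    (f' : 'I_n.+1 -> {rmorphism C -> T'}) :
    (forall l (a : A), f' l a%:A = h0' a) ->
    (forall l l', l != l' -> pairing x y (f' l) (f' l') = 0) ->
    exists h : {rmorphism B0 -> T'},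
      [/\ forall a, h a%:A = h0' a, forall l c, h (i0 l c) = f' (lift ord_max l) c
        & forall l, pairing x y (h \o i0 l)%FUN (f' ord_max) = 0].
  move=> f'A f'dis; have [|h [hA hi]] := univ0 _ h0' _ (fun l => f'A (lift ord_max l)).
    by move=> l l' ll'; apply: f'dis; rewrite (inj_eq lift_inj).
  exists h; split=> // l; rewrite -(f'dis (lift ord_max l) ord_max); last first.
    by rewrite eq_sym neq_lift.
  by apply: eq_pairing => c //; apply: hi.
have [h [hA hi hdis]] := step _ _ _ fA fdis.
have hfA a : h a%:A = f ord_max a%:A by rewrite hA fA.
have [B1 [i1 [z [zdis ext1 univ1]]]] := adjoin_point sepxy hfA hdis.
pose i l := if unlift ord_max l is Some l' then (i1 \o i0 l')%FUN : {lrmorphism C -> B1} else z.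
have il l : i (lift ord_max l) = (i1 \o i0 l)%FUN by rewrite /i liftK.
have im : i ord_max = z by rewrite /i unlift_none.
exists B1, i; split.
- move=> l l'; case: (unlift_max l) => [[k ->]| ->]; case: (unlift_max l') => [[k' ->]| ->].
  + rewrite (inj_eq lift_inj) => kk'; rewrite !il -(rmorph0 i1) -(i0dis _ _ kk').
    by rewrite pairing_rmorph.
  + by move=> _; rewrite il im zdis.
  + move=> _; rewrite il im; apply: (pairing_sym0 sepxy (f := (i1 \o i0 k')%FUN) (g := z)) (zdis _).
    by move=> a /=; rewrite !linearZ /= !rmorph1.
  + by rewrite eqxx.
- move=> T' g g' gA gi; apply: ext1 => [b|c]; last by rewrite -im.
  move: b; apply: (ext0 _ (g \o i1)%FUN (g' \o i1)%FUN) => [a|l c] /=.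
    by rewrite !linearZ /= !rmorph1.
  by have := gi (lift ord_max l) c; rewrite il.
- move=> T' h0' f' f'A f'dis; have [h' [h'A h'i h'dis]] := step _ _ _ f'A f'dis.
  have h'fA a : h' a%:A = f' ord_max a%:A by rewrite h'A f'A.
  have [g [gi gz]] := univ1 _ _ _ h'fA h'dis.
  exists g; split=> [a|l c]; first by rewrite -h'A -gi linearZ /= rmorph1.
  by case: (unlift_max l) => [[k ->]| ->]; rewrite ?im // il /= gi h'i.
Qed.

End Closure.

(** * Galois closures and traces *)

(* The dual bases express that B is Galois over the invariants B^H. Then B is
   generated by the X k, and B = tr(B) B, so the determinant trick gives an
   element of 1 + tr(B) annihilating B. *)
Section TraceOne.
Variables (hT : finGroupType) (H : {group hT}) (B : comNzRingType).
Variables (act : hT -> {rmorphism B -> B}) (N : nat) (X Y : 'I_N -> B).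
Hypothesis act1 : forall b, act 1%g b = b.
Hypothesis actM : forall s t b, act (s * t)%g b = act s (act t b).
Hypothesis dualXY :
  forall s, s \in H -> \sum_k X k * act s (Y k) = (s == 1%g)%:R.

Let tr b := \sum_(s in H) act s b.
Let inv a := forall s, s \in H -> act s a = a.

Lemma trace_one : exists b, tr b = 1.
Proof.
have trD b b' : tr (b + b') = tr b + tr b'.
  by rewrite -big_split; apply: eq_bigr => s _; rewrite rmorphD.
have trN b : tr (- b) = - tr b.
  by rewrite -sumrN; apply: eq_bigr => s _; rewrite rmorphN.
have trZ a b : inv a -> tr (a * b) = a * tr b.
  by move=> ia; rewrite mulr_sumr; apply: eq_bigr => s sH; rewrite rmorphM ia.
have inv_tr b : inv (tr b).
  move=> s sH; rewrite rmorph_sum [RHS](reindex_inj (mulgI s)) /=.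
  by apply: eq_big => [t|t _]; rewrite ?groupMl ?actM.
have XY1 : \sum_k X k * Y k = 1.
  transitivity ((1%g == 1%g :> hT)%:R : B); last by rewrite eqxx.
  rewrite -(dualXY (group1 H)).
  by apply: eq_bigr => k _; rewrite act1.
(* When the traces are expanded, duality leaves only the term of the identity. *)
have decomp b : b = \sum_k X k * tr (Y k * b).
  under eq_bigr => k _ do rewrite mulr_sumr.
  rewrite exchange_big (bigD1 1%g) //= [X in _ + X]big1 => [|s /andP[sH s1]].
    rewrite addr0 -[LHS]mul1r -XY1 mulr_suml.
    by apply: eq_bigr => k _; rewrite !act1 mulrA.
  transitivity ((\sum_k X k * act s (Y k)) * act s b).
    by rewrite mulr_suml; apply: eq_bigr => k _; rewrite rmorphM mulrA.
  by rewrite dualXY // (negPf s1) mul0r.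
(* Congruence, in the ring of invariants, modulo the ideal of traces. *)
pose cong a a' := [/\ inv a, inv a' & exists b, a - a' = tr b].
have inv0 : inv 0 by move=> s _; rewrite rmorph0.
have inv1 : inv 1 by move=> s _; rewrite rmorph1.
have invD a a' : inv a -> inv a' -> inv (a + a').
  by move=> ia ia' s sH; rewrite rmorphD ia ?ia'.
have invN a : inv a -> inv (- a) by move=> ia s sH; rewrite rmorphN ia.
have invM a a' : inv a -> inv a' -> inv (a * a').
  by move=> ia ia' s sH; rewrite rmorphM ia ?ia'.
have cong_refl a : inv a -> cong a a.
  by move=> ia; split=> //; exists 0; rewrite subrr /tr big1 // => s _; rewrite rmorph0.
have congD a a' c c' : cong a a' -> cong c c' -> cong (a + c) (a' + c').
  move=> [ia ia' [b ab]] [ic ic' [e ce]]; split; [exact: invD|exact: invD|].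
  by exists (b + e); rewrite trD -ab -ce opprD addrACA.
have congM a a' c c' : cong a a' -> cong c c' -> cong (a * c) (a' * c').
  move=> [ia ia' [b ab]] [ic ic' [e ce]]; split; [exact: invM|exact: invM|].
  exists (a * e + c' * b); rewrite trD !trZ // -ab -ce mulrBr mulrBr addrA.
  by rewrite (mulrC c' a) subrK (mulrC c').
pose M : 'M[B]_N := \matrix_(k, l) tr (Y l * X k).
(* By [decomp], [M] fixes the column [X], so the determinant kills each [X k] and thus 1. But the
   entries of [M] are traces, so it is also congruent to 1. *)
have det0 : \det (1%:M - M) = 0.
  rewrite -[LHS]mulr1 -[X in _ * X]XY1 mulr_sumr big1 // => k _.
  rewrite mulrA (det_sub1_annihilates (x := X)) ?mul0r // => i.
  by rewrite {1}[X i]decomp; apply: eq_bigr => j _; rewrite mxE mulrC.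
have [_ _ [b]] : cong (\det (1%:M - M)) (\det (1%:M : 'M[B]_N)).
  rewrite /determinant; apply: (big_ind2 cong); [exact: cong_refl|by move=> *; apply: (congD)|].
  move=> s _; apply: (congM).
    by apply: cong_refl; case: (odd_perm s); rewrite ?expr1 ?expr0 //; apply: invN.
  apply: (big_ind2 cong); [exact: cong_refl|by move=> *; apply: (congM)|].
  move=> i _; rewrite !mxE; split.
  - by apply: invD; [case: eqP|apply/invN/inv_tr].
  - by case: eqP.
  - by exists (- (Y (s i) * X i)); rewrite trN addrAC subrr add0r.
rewrite det0 det1 sub0r => b1; exists (- b).
by rewrite trN -b1 opprK.
Qed.

End TraceOne.

Section Fibres.
Variables (A : comNzRingType) (Omega : closedFieldType).
Variable xbar : {rmorphism A -> Omega}.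

(** A point [y] makes the values on the generators of C an eigenvector, with eigenvalue [y c], of a
    matrix of multiplication by [c]. It is nonzero because 1 is a combination of the generators. So
    [y c] is a root of a fixed characteristic polynomial. *)
Lemma fibre_values (C : comAlgType A) (c : C) : finite_module C ->
  exists R : seq Omega, forall y : fibre xbar C, y c \in R.
Proof.
move=> [s sP].
have [M ME] := choice (fun i : 'I_(size s) => sP (c * s`_i)).
pose g : 'M[Omega]_(size s) := \matrix_(i < size s, j < size s) xbar (M j i).
have [R RE] := closed_field_poly_normal (char_poly g).
exists R => y.
have : root (char_poly g) (y c).
  rewrite -eigenvalue_root_char; apply/eigenvalueP.
  exists (\row_i y s`_i).
    apply/rowP=> j; rewrite !mxE -rmorphM ME rmorph_sum.
    apply: eq_bigr => i _; rewrite !mxE -mulr_algl rmorphM fibre_over mulrC //.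
  apply/eqP => /rowP y0; have := rmorph1 y; have [a ->] := sP 1.
  rewrite rmorph_sum big1 => [/eqP|i _]; first by rewrite eq_sym oner_eq0.
  by have := y0 i; rewrite !mxE -mulr_algl rmorphM => ->; rewrite mulr0.
rewrite RE rootZ ?root_prod_XsubC // lead_coef_eq0.
by apply: monic_neq0; apply: char_poly_monic.
Qed.

Lemma fibre_enum (C : comAlgType A) : finite_module C ->
  exists (n : nat) (pt : 'I_n -> fibre xbar C),
    injective pt /\ forall y, exists l, pt l = y.
Proof.
move=> C_fin; have [s sP] := C_fin.
have [R RP] := choice (fun i : 'I_(size s) => fibre_values s`_i C_fin).
pose m := \max_i size (R i).
pose code (y : fibre xbar C) : {ffun 'I_(size s) -> 'I_m.+1} :=
  [ffun i : 'I_(size s) => inord (index (y s`_i) (R i))].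
have codeI y y' : code y = code y' -> y = y'.
  move=> /ffunP eyy'; apply: fibre_eq => c; have [a ->] := sP c.
  rewrite !rmorph_sum; apply: eq_bigr => i _.
  rewrite -mulr_algl !rmorphM !fibre_over; congr (_ * _).
  have lt_index (u : fibre xbar C) : (index (u s`_i)%R (R i) < m.+1)%N.
    rewrite ltnS (leq_trans (index_size _ _)) //.
    exact: (leq_bigmax i).
  have := eyy' i; rewrite !ffunE => /(congr1 val); rewrite /= !inordK // => e.
  by rewrite -(nth_index 0 (RP i y)) e nth_index.
pose S := [set k | `[< exists y, code y = k >]]%SET.
have SP (k : 'I_#|S|) : exists y, code y = enum_val k.
  by have := enum_valP k; rewrite inE => /asboolP.
have [pt ptP] := choice SP; exists #|S|, pt; split=> [k k' e|y].
  by apply: enum_val_inj; rewrite -!ptP e.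
have yS : code y \in S by rewrite inE; apply/asboolP; exists y.
by exists (enum_rank_in yS (code y)); apply: codeI; rewrite ptP enum_rankK_in.
Qed.

(** The point [z] of the configuration scheme is the tuple of all points of the fibre of C, and g
    moves it to a reordering of itself. The dual bases are the terms of the expanded product, over
    the coordinates, of the idempotents of the diagonal. *)
Lemma galois_closure (C : finite_etale A) :
  exists (n : nat) (pi : pi1 xbar -> 'S_n) (B : finite_etale A)
    (act : 'S_n -> {lrmorphism B -> B}) (z : fibre xbar B)
    (N : nat) (X Y : 'I_N -> B),
  [/\ forall g h, pi (pi1_mul g h) = (pi g * pi h)%g,
      forall g h : pi1 xbar, pi g = pi h -> forall y : fibre xbar C, g C y = h C y,
      forall g : pi1 xbar, g B z = fibre_comp (act (pi g)) z,
      (forall b, act 1%g b = b) /\ forall s t b, act (s * t)%g b = act s (act t b)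
    & forall s, \sum_k X k * act s (Y k) = (s == 1%g)%:R].
Proof.
have [n [pt [ptI ptS]]] := fibre_enum (fet_finite C).
have [m [x [y sepxy]]] := etale_separating (fet_etale C).
have pdis l l' : l != l' -> pairing x y (pt l) (pt l') = 0.
  move=> ll'; apply: (pairing_field sepxy) => [a|]; first by rewrite !fibre_over.
  by move/fibre_eq/ptI/eqP; rewrite (negPf ll').
have [B [i [idis ext univ]]] :=
  configuration_algebra sepxy (fun l => fibre_over (pt l)) pdis.
have [z0 [z0A z0i]] := univ _ _ _ (fun l => fibre_over (pt l)) pdis.
pose z : fibre xbar B := Fibre z0A.
have zi l : fibre_comp (i l) z = pt l by apply: fibre_eq => c; apply: z0i.
have actP (s : 'S_n) : exists h : {lrmorphism B -> B},
    forall l c, h (i l c) = i (s^-1 l)%g c.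
  have [||h [hA hi]] := univ _ (GRing.in_alg B) (fun l => i (s^-1 l)%g).
  - by move=> l a; rewrite /= linearZ /= rmorph1.
  - by move=> l l' ll'; apply: idis; rewrite (inj_eq perm_inj).
  have [h' h'E] := lrmorphism_of hA.
  by exists h' => l c; rewrite h'E hi.
have [act actE] := choice actP.
have actA s (a : A) : act s a%:A = a%:A by rewrite linearZ /= rmorph1.
have ptM (g : pi1 xbar) l : exists l', g C (pt l) = pt l'.
  by have [l' <-] := ptS (g C (pt l)); exists l'.
have sgP (g : pi1 xbar) : exists s : 'S_n, forall l, g C (pt l) = pt (s l).
  have [f fE] := choice (ptM g).
  have fI : injective f.
    by move=> l l' e; apply/ptI/(bij_inj (pi1_bij g C)); rewrite !fE e.
  by exists (perm fI) => l; rewrite permE.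
have [sg sgE] := choice sgP.
(* Permutations compose from left to right, which makes [sg] an anti-homomorphism; the inverse
   corrects this. *)
pose pi g := ((sg g)^-1)%g.
pose K := {ffun 'I_n -> 'I_m}.
pose X (k : 'I_#|K|) := \prod_l i l (x (enum_val k l)).
pose Y (k : 'I_#|K|) := \prod_l i l (y (enum_val k l)).
exists n, pi, B, act, z, #|K|, X, Y; split.
- move=> g h; rewrite /pi -invMg; congr (_^-1)%g; apply/permP=> l; rewrite permM.
  by apply: ptI; rewrite -sgE /= -!sgE.
- move=> g h /invg_inj e y'; have [l <-] := ptS y'.
  by rewrite !sgE e.
- move=> g; apply: fibre_eq; apply: ext => [a|l c]; first by rewrite !fibre_over.
  rewrite -[LHS]/(fibre_comp (i l) (g B z) c) -pi1_natural zi sgE /=.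
  by rewrite actE invgK z0i.
- split=> [|s t]; first by apply: (ext _ _ idfun) => [a|l c] /=; rewrite ?actA // actE invg1 perm1.
  apply: (ext _ _ (act s \o act t)%FUN) => [a|l c] /=; first by rewrite !actA.
  by rewrite !actE invMg permM.
(* If [s] moves a coordinate, the corresponding factor pairs two distinct coordinates and is 0. *)
- move=> s; transitivity (\prod_l pairing x y (i l) (i (s^-1 l)%g)).
    rewrite bigA_distr_bigA (reindex _ (onW_bij _ (enum_val_bij K))) /=.
    apply: eq_bigr => k _; rewrite /X /Y rmorph_prod -big_split /=.
    by apply: eq_bigr => l _; rewrite actE.
  have [->|s1] := eqVneq s 1%g.
    by rewrite big1 // => l _; rewrite invg1 perm1 (pairing_diag sepxy).
  have [l sl] : exists l, s^-1%g l != l.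
    apply/existsP; rewrite -negb_forall; apply: contra s1 => /forallP s1.
    by rewrite -eq_invg1; apply/eqP/permP => l; rewrite perm1; apply/eqP.
  by rewrite (bigD1 l) //= idis ?mul0r // eq_sym.
Qed.

End Fibres.

(** * Embedding problems *)

Lemma Fp_fermat (p : nat) (x : 'F_p) : prime p -> x ^+ p = x.
Proof. by move=> p_prime; rewrite -{2}(expf_card x) card_Fp. Qed.

Section Cocycle.
Variables (p : nat) (B : comNzRingType) (pB : p \in [pchar B]).
Variables (phi : {rmorphism 'F_p -> B}) (hT : finGroupType) (H : {group hT}).
Variable act : hT -> {rmorphism B -> B}.
Hypothesis actM : forall s t b, act (s * t)%g b = act s (act t b).
Hypothesis act_phi : forall s x, act s (phi x) = phi x.
Variables (d : nat) (R : hT -> 'M['F_p]_d) (c : hT -> hT -> 'rV['F_p]_d).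
Hypothesis cocycle : forall s t u, s \in H -> t \in H -> u \in H ->
  c t u *m R s + c s (t * u)%g = c (s * t)%g u + c s t.

(** The diagonal action of [s] on V (x) B, with V the space of rows over F_p on which [s] acts by
    right multiplication by [R s]; [frob] is the Frobenius of the factor B. *)
Definition twist s (v : 'rV[B]_d) : 'rV[B]_d :=
  map_mx (act s) v *m map_mx phi (R s).
Definition frob : 'rV[B]_d -> 'rV[B]_d := map_mx (pFrobenius_aut pB).

Fact twist_is_zmod s : zmod_morphism (twist s).
Proof. by move=> v w; rewrite /twist map_mxB mulmxBl. Qed.
HB.instance Definition _ s := GRing.isZmodMorphism.Build _ _ (twist s) (twist_is_zmod s).

Fact frob_is_zmod : zmod_morphism frob.
Proof. by move=> v w; rewrite /frob map_mxB. Qed.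
HB.instance Definition _ := GRing.isZmodMorphism.Build _ _ frob frob_is_zmod.

Lemma twistZ s x v : twist s (x *: v) = act s x *: twist s v.
Proof. by rewrite /twist map_mxZ scalemxAl. Qed.

Lemma map_act_phi s m n (M : 'M['F_p]_(m, n)) :
  map_mx (act s) (map_mx phi M) = map_mx phi M.
Proof. by apply/matrixP=> i j; rewrite !mxE act_phi. Qed.

Lemma twist_phi s w : twist s (map_mx phi w) = map_mx phi (w *m R s).
Proof. by rewrite /twist map_act_phi map_mxM. Qed.

Lemma frob_phi m n (M : 'M['F_p]_(m, n)) :
  map_mx (pFrobenius_aut pB) (map_mx phi M) = map_mx phi M.
Proof.
apply/matrixP=> i j; rewrite !mxE !pFrobenius_autE -rmorphXn Fp_fermat //.
exact: pcharf_prime pB.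
Qed.

Lemma frob_twist s v : frob (twist s v) = twist s (frob v).
Proof.
rewrite /frob /twist map_mxM frob_phi; congr (_ *m _).
by apply/matrixP=> i j; rewrite !mxE !pFrobenius_autE rmorphXn.
Qed.

(* H^2(H, V) -> H^2(H, V (x) B) and H^1(H, V (x) B) vanish because b has trace
   1; the Artin-Schreier operator F - 1 relates the two splittings e and f. *)
Lemma cocycle_splitting b : \sum_(s in H) act s b = 1 ->
  exists (e : hT -> 'rV[B]_d) (f : 'rV[B]_d),
    (forall s t, s \in H -> t \in H ->
       twist s (e t) + e s = e (s * t)%g + map_mx phi (c s t)) /\
    (forall s, s \in H -> frob (e s) - e s = twist s f - f).
Proof.
move=> trb.
have shift (V : nmodType) s (F : hT -> V) : s \in H ->
    \sum_(t in H) F (s * t)%g = \sum_(t in H) F t.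
  move=> sH; rewrite [RHS](reindex_inj (mulgI s)) /=.
  by apply: eq_bigl => t; rewrite groupMl.
pose e s := \sum_(t in H) act (s * t)%g b *: map_mx phi (c s t).
have eM s t : s \in H -> t \in H ->
    twist s (e t) + e s = e (s * t)%g + map_mx phi (c s t).
  move=> sH tH; have -> : e s = \sum_(u in H) act (s * (t * u))%g b *: map_mx phi (c s (t * u)%g).
    by rewrite (shift _ t (fun u => act (s * u)%g b *: map_mx phi (c s u))).
  have -> : map_mx phi (c s t) = \sum_(u in H) act (s * t * u)%g b *: map_mx phi (c s t).
    rewrite -scaler_suml (shift _ _ (fun u => act u b)) ?groupM //.
    by rewrite trb scale1r.
  rewrite raddf_sum -!big_split /=; apply: eq_bigr => u uH.
  by rewrite twistZ -actM mulgA twist_phi -!scalerDr -!map_mxD cocycle.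
(* As [c] has coefficients in F_p, it is fixed by Frobenius and cancels: [k] is a 1-cocycle. *)
pose k s := frob (e s) - e s.
have kM s t : s \in H -> t \in H -> twist s (k t) = k (s * t)%g - k s.
  move=> sH tH; rewrite /k raddfB /= -frob_twist.
  have -> : twist s (e t) = e (s * t)%g + map_mx phi (c s t) - e s.
    by rewrite -eM // addrK.
  rewrite raddfB raddfD /= [frob (map_mx _ _)]frob_phi.
  move: (frob _) (frob _) (map_mx _ _) => u v w; rewrite !opprD !opprK !addrA.
  by rewrite (addrAC v w) (addrAC _ w) addrK (addrAC v).
exists e, (- \sum_(t in H) act t b *: k t); split=> // s sH.
transitivity (\sum_(t in H) act (s * t)%g b *: k s).
  by rewrite -scaler_suml (shift _ _ (fun u => act u b)) // trb scale1r.
rewrite raddfN raddf_sum opprK [RHS]addrC /=.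
rewrite -(shift _ s (fun t => act t b *: k t)) // -sumrB.
apply: eq_bigr => t tH; rewrite twistZ -actM -scalerBr kM //.
by rewrite opprB addrCA subrr addr0.
Qed.

End Cocycle.

(** The trivial group is treated apart, with [d = 0], because [abelem_repr] takes a nontrivial
    group. *)
Lemma abelem_coordinates (p : nat) (gT : finGroupType) (M : {group gT}) :
  prime p -> (p.-abelem M)%g -> [set: gT] \subset ('N(M))%g ->
  exists (d : nat) (v : gT -> 'rV['F_p]_d) (w : 'rV['F_p]_d -> gT)
         (R : gT -> 'M['F_p]_d),
  [/\ forall u, w u \in M /\ v (w u) = u, forall x, x \in M -> w (v x) = x,
      forall u u', w (u + u') = (w u * w u')%g,
      forall x u, w (u *m R x) = ((w u) ^ x)%g
    & R 1%g = 1%:M /\ forall x y, R (x * y)%g = R x *m R y].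
Proof.
move=> p_prime abelM nM; have [M1|ntM] := eqVneq (M : {set gT}) 1%g.
  exists 0%N, (fun=> 0), (fun=> 1%g), (fun=> 0).
  split=> [u|x|u u'|x u|]; last by split=> *; rewrite ?mulmx0 // [RHS]flatmx0.
  - by rewrite group1; split=> //; apply/esym/thinmx0.
  - by rewrite M1 => /set1P ->.
  - by rewrite mulg1.
  - by rewrite conj1g.
pose rG := abelem_repr abelM ntM (nM : [group of [set: gT]] \subset _).
exists _, (abelem_rV abelM ntM), (rVabelem abelM ntM), rG; split.
- by move=> u; rewrite mem_rVabelem rVabelemK.
- exact: abelem_rV_K.
- exact: rVabelemD.
- by move=> x u; rewrite rVabelemJ ?inE.
- by split=> [|x y]; [apply: repr_mx1|apply: repr_mxM; rewrite inE].
Qed.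

Lemma closed_artin_schreier_root (p : nat) (K : closedFieldType) (a : K) :
  prime p -> exists x, x ^+ p - x = a.
Proof.
move=> p_prime; have p_gt1 := prime_gt1 p_prime.
have [x xE] := @solve_monicpoly K p
  (fun i => (i == 0%N)%:R * a + (i == 1%N)%:R) (ltnW p_gt1).
exists x; rewrite xE.
rewrite (bigD1 (Ordinal (ltnW p_gt1))) //= (bigD1 (Ordinal p_gt1)) //= big1.
  by rewrite mul1r mul0r !addr0 add0r expr0 expr1 mulr1 mul1r addrK.
move=> i /andP[]; rewrite -!val_eqE /= => /negPf -> /negPf ->.
by rewrite mul0r addr0 mul0r.
Qed.

Lemma frobenius_fixed (p : nat) (K : fieldType) (phi : {rmorphism 'F_p -> K}) (x : K) :
  prime p -> x ^+ p = x -> exists a, x = phi a.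
Proof.
move=> p_prime xp.
have : root (map_poly phi ('X^#|'F_p| - 'X)) x.
  by rewrite card_Fp // rmorphB /= map_polyXn map_polyX /root !hornerE xp subrr.
rewrite finField_genPoly rmorph_prod /=.
under eq_bigr => a _ do rewrite rmorphB /= map_polyX map_polyC /=.
rewrite /root horner_prod prodf_seq_eq0 => /hasP[a _ /=].
by rewrite hornerXsubC subr_eq0 => /eqP ->; exists a.
Qed.

Section Pi1.
Variables (A : comNzRingType) (Omega : closedFieldType).
Variable xbar : {rmorphism A -> Omega}.
Local Notation G := (pi1 xbar).

Lemma pi1_ext (s t : G) : (forall B y, s B y = t B y) -> s = t.
Proof.
case: s t => s sb sn [t tb tn] /= st.
have {}st : s = t.
  by apply: functional_extensionality_dep => B; apply: functional_extensionality_dep.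
by subst t; rewrite (Prop_irrelevance sb tb) (Prop_irrelevance sn tn).
Qed.

Lemma pi1_one_exists : exists s : G, forall B y, s B y = y.
Proof.
by exists (@Pi1 A Omega xbar (fun B y => y) (fun B => inv_bij (fun y => erefl))
  (fun B C h z => erefl)).
Qed.

Lemma pi1_inv_exists (s : G) : exists t : G, forall B y, s B (t B y) = y.
Proof.
have [t tE] : {t : forall B : finite_etale A, fibre xbar B -> fibre xbar B |
    forall B, cancel (s B) (t B) /\ cancel (t B) (s B)}.
  have e (B : finite_etale A) : exists t : fibre xbar B -> fibre xbar B,
      cancel (s B) t /\ cancel t (s B).
    by have [t st ts] := pi1_bij s B; exists t.
  by exists (fun B => sval (cid (e B))) => B; case: cid.
have tb B : bijective (t B) by exists (s B); apply (tE B).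
have tn (B C : finite_etale A) (h : {lrmorphism B -> C}) (z : fibre xbar C) :
    t B (fibre_comp h z) = fibre_comp h (t C z).
  by apply: (can_inj (tE B).1); rewrite (tE B).2 pi1_natural (tE C).2.
by exists (Pi1 tb tn) => B y /=; rewrite (tE B).2.
Qed.

(** A uniform continuity for the discrete topology on T: [alpha] depends only on the permutation of
    a single finite fibre. *)
Definition factors_through (C : finite_etale A) (T : Type) (alpha : G -> T) :=
  forall s t : G, (forall y : fibre xbar C, s C y = t C y) -> alpha s = alpha t.

End Pi1.

(* Let E be the group of the Theta_(s, u) : B1 -> B1 extending the action of s on
   B by y |-> (y + e s + u) S(s), where F y - y = f. The point z1 of B1 identifies
   g in pi1 with the Theta such that g z1 = z1 o Theta, and u, as a function of g,
   splits the cocycle c. *)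
Section Embedding.
Variables (A : comNzRingType) (Omega : closedFieldType).
Variable xbar : {rmorphism A -> Omega}.
Local Notation G := (pi1 xbar).

Lemma abelem_lift (p : nat) (p_prime : prime p) (i0 : {rmorphism 'F_p -> A})
    (gT : finGroupType) (M : {group gT}) (abelM : (p.-abelem M)%g)
    (nM : [set: gT] \subset ('N(M))%g) (C : finite_etale A) (alpha : G -> gT) :
  factors_through C alpha ->
  (forall g h, alpha g * alpha h * (alpha (pi1_mul g h))^-1 \in M)%g ->
  exists (C' : finite_etale A) (beta : G -> gT),
  [/\ factors_through C' beta,
      forall g h, beta (pi1_mul g h) = (beta g * beta h)%g
    & forall g, (beta g * (alpha g)^-1)%g \in M].
Proof.
move=> alphaC alphaM.
have [n [pi [B [act [z [N [X [Y [piM piC gz [act1 actM] dual]]]]]]]]] :=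
  galois_closure xbar C.
have [d [v [w [R [wv vK wD wJ [R1 RM]]]]]] := abelem_coordinates p_prime abelM nM.
have wM u : w u \in M := (wv u).1.
have wK u : v (w u) = u := (wv u).2.
have wI : injective w := can_inj wK.
have pA : p \in [pchar A] by apply: (rmorph_pchar i0); apply: pchar_Fp.
have pB : p \in [pchar B] by apply: (rmorph_pchar (GRing.in_alg B)).
have [one oneE] := pi1_one_exists xbar.
have pi_one : pi one = 1%g.
  apply: (mulgI (pi one)); rewrite -piM mulg1; congr pi.
  by apply: pi1_ext => D y /=; rewrite !oneE.
have mulNM (x y : gT) : y \in M -> (y ^ x \in M)%g.
  by move=> yM; rewrite memJ_norm // (fintype.subsetP nM) ?inE.
have cMM (x y : gT) : x \in M -> y \in M -> (x * y = y * x)%g.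
  by move=> xM yM; apply: (centsP (abelem_abelian abelM)).
have conjM (x y : gT) : x \in M -> y \in M -> (x ^ y = x)%g.
  by move=> xM yM; rewrite conjgE (cMM x y) // mulKg.
pose H0 := [set s : 'S_n | `[< exists g, pi g = s >]]%SET.
have piH0 g : pi g \in H0 by rewrite inE; apply/asboolP; exists g.
have H0g : group_set H0.
  apply/group_setP; split=> [|s t]; first by rewrite -pi_one.
  by rewrite !inE => /asboolP[g <-] /asboolP[h <-]; apply/asboolP; exists (pi1_mul g h).
pose H : {group 'S_n} := Group H0g.
have piH g : pi g \in H by apply: piH0.
have [sec secK] : {sec : 'S_n -> G | forall s, s \in H -> pi (sec s) = s}.
  have e (s : 'S_n) : exists g, s \in H -> pi g = s.
    have [|sH] := boolP (s \in H); last by exists one.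
    by rewrite inE => /asboolP[g gs]; exists g.
  by exists (fun s => sval (cid (e s))) => s; case: cid.
(* [alpha] factors through the finite group H as [a]; [kap], the failure of [a] to be
   multiplicative, is a 2-cocycle with values in M. *)
pose a s := alpha (sec s).
have alphaE g : alpha g = a (pi g).
  by apply: alphaC; apply: piC; rewrite secK.
pose kap s t := (a s * a t * (a (s * t))^-1)%g.
have kapM s t : s \in H -> t \in H -> kap s t \in M.
  move=> sH tH; rewrite /kap; have -> : a (s * t)%g = alpha (pi1_mul (sec s) (sec t)).
    by rewrite alphaE piM !secK.
  exact: alphaM.
have aM s t : (a s * a t = kap s t * a (s * t))%g by rewrite mulgKV.
clearbody kap.
(* [RR s] is conjugation of M by [a s] on the left, as a matrix acting on rows, whence the inverse
   and the reversed products; [S s] is its inverse. *)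
pose RR s := R (a s)^-1%g.
pose S s := R (a s).
have RS s : RR s *m S s = 1%:M by rewrite -RM mulVg R1.
have SR s : S s *m RR s = 1%:M by rewrite -RM mulgV R1.
(* Although [a] is not multiplicative, its defect [kap] lies in the abelian group M and acts
   trivially on it. *)
have RRM s t : s \in H -> t \in H -> RR t *m RR s = RR (s * t)%g.
  move=> sH tH; apply/row_matrixP=> i; rewrite !rowE; move: (delta_mx _ _) => u.
  apply: wI; rewrite mulmxA !wJ -conjgM -invMg aM invMg conjgM.
  by rewrite (conjM _ (kap s t)^-1)%g ?mulNM ?wM ?groupV ?kapM.
have SM s t : s \in H -> t \in H -> S s *m S t = S (s * t)%g.
  move=> sH tH; rewrite -[LHS]mulmx1 -(RS (s * t)%g) -RRM //.
  by rewrite !mulmxA -(mulmxA (S s)) SR mulmx1 SR mul1mx.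
pose c s t := v (kap s t).
have wc s t : s \in H -> t \in H -> w (c s t) = kap s t.
  by move=> sH tH; rewrite vK ?kapM.
have cocycle s t u : s \in H -> t \in H -> u \in H ->
    c t u *m RR s + c s (t * u)%g = c (s * t)%g u + c s t.
  move=> sH tH uH; apply: wI; rewrite [in RHS]addrC !wD wJ !wc ?groupM //.
  apply: (mulIg (a (s * (t * u))%g)); transitivity (a s * a t * a u)%g.
    rewrite -mulgA -aM conjgE invgK -!mulgA mulKg.
    by rewrite -aM.
  by rewrite (mulgA s t u) -(mulgA (kap s t)) -aM (mulgA (kap s t)) -aM.
pose actr s : {rmorphism B -> B} := act s.
pose phi : {rmorphism 'F_p -> B} := (GRing.in_alg B \o i0)%FUN.
have act_phi s x : actr s (phi x) = phi x by rewrite /actr /= linearZ /= rmorph1.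
have dualH s : s \in H -> \sum_k X k * actr s (Y k) = (s == 1%g)%:R.
  by move=> _; apply: dual.
have [b trb] := trace_one act1 actM dualH.
have actrM s t x : actr (s * t)%g x = actr s (actr t x) := actM s t x.
have [e [f [eM ef]]] := cocycle_splitting pB actrM act_phi cocycle trb.

(* Roots in Omega give a geometric point [z1] above [z], which also shows that the covering is not
   empty. *)
pose root_f j := closed_artin_schreier_root (z (f 0 j)) p_prime.
have [t tE] := choice root_f.
have [B1 [io [y [yE ext univ]]]] := artin_schreier_multi pA tE.
have [z1r [z1io z1y]] := univ _ _ _ tE.
have ioA (x : A) : io x%:A = x%:A by rewrite linearZ /= rmorph1.
have z1A (x : A) : z1r x%:A = xbar x by rewrite -ioA z1io fibre_over.
pose z1 : fibre xbar B1 := Fibre z1A.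
have z1z : fibre_comp io z1 = z by apply: fibre_eq => x; apply: z1io.
have pB1 : p \in [pchar B1] by apply: (rmorph_pchar (GRing.in_alg B1)).
pose phi1 : {rmorphism 'F_p -> B1} := (GRing.in_alg B1 \o i0)%FUN.
pose psi : {rmorphism 'F_p -> Omega} := (xbar \o i0)%FUN.
have iophi k l (Z : 'M['F_p]_(k, l)) : map_mx io (map_mx phi Z) = map_mx phi1 Z.
  by apply/matrixP=> i j; rewrite !mxE /= ioA.
have lphi1 (T : {lrmorphism B1 -> B1}) k l (Z : 'M['F_p]_(k, l)) :
    map_mx T (map_mx phi1 Z) = map_mx phi1 Z.
  by apply/matrixP=> i j; rewrite !mxE /= linearZ /= rmorph1.
have z1phi k l (Z : 'M['F_p]_(k, l)) : map_mx z1 (map_mx phi1 Z) = map_mx psi Z.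
  by apply/matrixP=> i j; rewrite !mxE /= z1A.
pose yv : 'rV[B1]_d := \row_j y j.
pose Yv s u := (yv + map_mx io (e s) + map_mx phi1 u) *m map_mx phi1 (S s).
pose Fr : 'rV[B1]_d -> 'rV[B1]_d := frob pB1 (d := d).
(* Applying F - 1 to y + e s + u gives f + (F e s - e s), the twist of f by s; the factor [S s]
   undoes the matrix part and leaves the image of f under s, so that Theta_(s, u) is well
   defined. *)
have frYv s u : s \in H ->
    Fr (Yv s u) - Yv s u = map_mx io (map_mx (actr s) f).
  move=> sH; have -> : map_mx (actr s) f = twist phi actr RR s f *m map_mx phi (S s).
    by rewrite /twist -mulmxA -map_mxM RS map_mx1 mulmx1.
  have -> : twist phi actr RR s f = f + (frob pB (e s) - e s).
    by rewrite (ef s sH) addrC subrK.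
  rewrite map_mxM iophi /Fr /frob /Yv map_mxM frob_phi -mulmxBl; congr (_ *m _).
  rewrite !map_mxD !frob_phi opprD addrACA subrr addr0 opprD addrACA map_mxN.
  congr (_ + (_ - _)); apply/rowP=> j; rewrite !mxE.
    exact: yE.
  exact/esym/rmorphXn.
have thetaP s u : s \in H -> exists T : {lrmorphism B1 -> B1},
    (forall x, T (io x) = io (act s x)) /\ map_mx T yv = Yv s u.
  move=> sH; have [|h [hio hy]] := univ _ (io \o act s)%FUN (Yv s u 0).
    move=> j; have /rowP/(_ j) := frYv s u sH.
    by rewrite !mxE.
  have [T TE] : exists T : {lrmorphism B1 -> B1}, T =1 h.
    by apply: lrmorphism_of => x; rewrite -ioA hio /= linearZ /= rmorph1.
  exists T; split=> [x|]; first by rewrite TE hio.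
  by apply/rowP=> j; rewrite [LHS]mxE [yv _ _]mxE TE hy.
(* The composition law of the Theta_(s, u) is that of the extension of H by V defined by [c]. *)
have YvM (T : {lrmorphism B1 -> B1}) s t' u u' : s \in H -> t' \in H ->
    (forall x, T (io x) = io (act s x)) -> map_mx T yv = Yv s u ->
    map_mx T (Yv t' u') = Yv (s * t')%g (u + u' *m RR s + c s t').
  move=> sH tH Tio Ty; rewrite [in LHS]/Yv map_mxM lphi1 !map_mxD Ty lphi1.
  have -> : map_mx T (map_mx io (e t')) = map_mx io (map_mx (actr s) (e t')).
    by apply/rowP=> j; rewrite !mxE Tio.
  rewrite /Yv -SM // map_mxM mulmxA; congr (_ *m _).
  have undo q (Z : 'M[B1]_(q, d)) : Z = Z *m map_mx phi1 (RR s) *m map_mx phi1 (S s).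
    by rewrite -mulmxA -map_mxM RS map_mx1 mulmx1.
  rewrite [map_mx io (map_mx _ _)]undo [map_mx phi1 u']undo -!mulmxDl.
  congr (_ *m _); rewrite -map_mxM.
  have -> : map_mx io (map_mx (actr s) (e t')) *m map_mx phi1 (RR s) =
      map_mx io (e (s * t')%g) + map_mx phi1 (c s t') - map_mx io (e s).
    rewrite -iophi -map_mxM -[_ *m _]/(twist phi actr RR s (e t')).
    rewrite -(iophi _ _ (c s t')) -map_mxD -(eM s t') // map_mxD addrK //.
  rewrite !map_mxD; move: (map_mx io (e s)) (map_mx phi1 u) (map_mx io _) => v1 v2 v3.
  move: (map_mx phi1 _) (map_mx phi1 _) => v4 v5.
  rewrite -!addrA; congr (_ + _); rewrite !addrA; move: (map_mx io _) => v6.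
  by rewrite (addrC v3) (addrAC v2 v3) (addrAC _ v3) addrK (addrC v2) (addrAC _ v5).
have YvI s u u' : map_mx z1 (Yv s u) = map_mx z1 (Yv s u') -> u = u'.
  rewrite /Yv !map_mxM !map_mxD !z1phi => /(congr1 (mulmxr (map_mx psi (RR s)))) /=.
  rewrite -!mulmxA -!map_mxM SR map_mx1 !mulmx1 => /addrI.
  by move/map_mx_inj; apply.
(* The points g z1 and z1 o Theta_(pi g, 0) agree on B, so their coordinates solve the same
   Artin-Schreier equations and differ by elements of F_p. The factor [RR] in the witness cancels
   the [S] in [Yv]. *)
have zgP (g : G) : exists u, map_mx (g B1 z1) yv = map_mx z1 (Yv (pi g) u).
  have [T0 [T0io T0y]] := thetaP (pi g) 0 (piH g).
  have zgio x : g B1 z1 (io x) = z1 (T0 (io x)).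
    rewrite -[LHS]/(fibre_comp io (g B1 z1) x) -pi1_natural z1z gz /=.
    by rewrite T0io z1io.
  have pO : p \in [pchar Omega] by apply: (rmorph_pchar xbar).
  have fixed j : exists x, g B1 z1 (y j) - z1 (T0 (y j)) = psi x.
    apply: frobenius_fixed => //; rewrite exprB_pchar //.
    have yp : y j ^+ p = y j + io (f 0 j) by rewrite -yE addrC subrK.
    by rewrite -!rmorphXn yp !rmorphD /= zgio opprD addrACA subrr addr0.
  have [x xE] := choice fixed.
  exists ((\row_j x j) *m RR (pi g)).
  have -> : Yv (pi g) ((\row_j x j) *m RR (pi g)) = map_mx T0 yv + map_mx phi1 (\row_j x j).
    rewrite T0y /Yv map_mx0 addr0 mulmxDl; congr (_ + _).
    by rewrite -map_mxM -mulmxA RS mulmx1.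
  rewrite map_mxD z1phi; apply/rowP=> j; rewrite !mxE -xE addrC subrK //.
have [wg wgE] := choice zgP.
(* By naturality (g h) z1 = g (z1 o Th) = (g z1) o Th = z1 o Tg o Th; comparison with [YvM] gives
   the law of [wg]. *)
have wgM g h : wg (pi1_mul g h) = wg g + wg h *m RR (pi g) + c (pi g) (pi h).
  have [Tg [Tgio Tgy]] := thetaP (pi g) (wg g) (piH g).
  have [Th [Thio Thy]] := thetaP (pi h) (wg h) (piH h).
  have ptE (k : G) (T : {lrmorphism B1 -> B1}) : (forall x, T (io x) = io (act (pi k) x)) ->
      map_mx T yv = Yv (pi k) (wg k) -> k B1 z1 = fibre_comp T z1.
    move=> Tio Ty; apply: fibre_eq; apply: ext => [x|j].
      rewrite -[LHS]/(fibre_comp io (k B1 z1) x) -pi1_natural z1z gz /=.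
      by rewrite Tio z1io.
    by have /rowP/(_ j) := wgE k; rewrite -Ty !mxE => ->.
  apply: (YvI (pi (pi1_mul g h))); rewrite -wgE piM -(YvM Tg) ?piH // -Thy /=.
  rewrite (ptE h Th) // pi1_natural (ptE g Tg) //.
  by apply/rowP=> j; rewrite !mxE.
(* The action on B is free at [z]: if s and t give the same point, then sum_k z(s X_k) z(t Y_k) is
   1, whereas duality makes it 0 when s and t differ. *)
have pi_inj (g h : G) : (forall x : fibre xbar B1, g B1 x = h B1 x) -> pi g = pi h.
  move=> gh; have zgh x : z (act (pi g) x) = z (act (pi h) x).
    rewrite -[LHS]/(fibre_comp (act (pi g)) z x) -[RHS]/(fibre_comp (act (pi h)) z x).
    by rewrite -!gz -z1z !pi1_natural gh.
  have XY1 : \sum_k X k * Y k = 1.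
    transitivity ((1%g == 1%g :> 'S_n)%:R : B); last by rewrite eqxx.
    by rewrite -dual; apply: eq_bigr => k _; rewrite act1.
  have : z (act (pi g) (\sum_k X k * act ((pi g)^-1 * pi h)%g (Y k))) =
         z (act (pi g) (\sum_k X k * Y k)).
    rewrite !linear_sum !rmorph_sum /=; apply: eq_bigr => k _.
    by rewrite !rmorphM /= -actM mulKVg -zgh.
  rewrite dual XY1 !rmorph1; case: eqP => [e1 _|_ /eqP].
    by apply/eqP; rewrite eq_mulVg1 e1.
  by rewrite !rmorph0 eq_sym oner_eq0.
exists B1, (fun g => w (wg g) * alpha g)%g; split.
- move=> g h gh; have pgh := pi_inj _ _ gh.
  rewrite !alphaE pgh; congr (w _ * _)%g; apply: (YvI (pi h)).
  by rewrite -[in LHS]pgh -!wgE gh.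
- move=> g h; rewrite !alphaE wgM !wD piM wJ wc ?piH // -!mulgA -aM.
  by rewrite invgK mulKg.
- by move=> g; rewrite mulgK.
Qed.

End Embedding.

(** Induction on the order of N. The subgroup M generated by the elements of order p in the center
    of N is elementary abelian, and normal since it is characteristic in N. Lift to the quotient by
    M, choose representatives, then apply [abelem_lift]. *)
Lemma pgroup_lift (A : comNzRingType) (Omega : closedFieldType)
    (xbar : {rmorphism A -> Omega}) (p : nat) (p_prime : prime p)
    (i0 : {rmorphism 'F_p -> A}) (gT : finGroupType) (N : {group gT})
    (C : finite_etale A) (alpha : pi1 xbar -> gT) :
  (p.-group N)%g -> [set: gT] \subset ('N(N))%g -> factors_through C alpha ->
  (forall g h, alpha g * alpha h * (alpha (pi1_mul g h))^-1 \in N)%g ->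
  exists (C' : finite_etale A) (beta : pi1 xbar -> gT),
  [/\ factors_through C' beta,
      forall g h, beta (pi1_mul g h) = (beta g * beta h)%g
    & forall g, (beta g * (alpha g)^-1)%g \in N].
Proof.
have [k] := ubnP #|N|; elim: k gT N alpha => // k IHk gT N alpha ltNk pN nN alphaC alphaN.
have [N1|ntN] := eqVneq (N : {set gT}) 1%g.
  exists C, alpha; split=> [//|g h|g]; last by rewrite mulgV group1.
  by apply/esym/eqP; rewrite eq_mulgV1; have := alphaN g h; rewrite N1 => /set1P ->.
pose M := ('Ohm_1('Z(N)))%G.
have sMN : M \subset N := fintype.subset_trans (Ohm_sub 1 _) (center_sub N).
have abelM : (p.-abelem M)%g.
  by apply: Ohm1_abelem (center_abelian N); apply: pgroupS (center_sub N) pN.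
have ntM : M :!=: 1%g.
  by rewrite Ohm1_eq1 center_nil_eq1 // (pgroup_nil pN).
have nM : [set: gT] \subset ('N(M))%g.
  by apply: char_norm_trans nN; apply: char_trans (center_char N); apply: Ohm_char.
have NM x : (x \in 'N(M))%g by apply: (fintype.subsetP nM); rewrite inE.
have nMN : (M <| N)%g by rewrite /normal sMN (fintype.subset_trans (finset.subsetT N)).
pose q : gT -> coset_of M := coset M.
have qM x y : q (x * y)%g = (q x * q y)%g by apply: morphM.
have qV x : q x^-1%g = (q x)^-1%g by apply: morphV.
have qN x : (q x \in N / M)%g = (x \in N).
  apply/idP/idP=> xN; last exact: mem_quotient.
  by rewrite -(quotientGK nMN); apply: mem_morphpre xN; apply: NM.
have [||||g h|C1 [beta1 [beta1C beta1M beta1N]]] := IHk _ (N / M)%G (q \o alpha).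
- by rewrite -ltnS; apply: leq_trans ltNk; rewrite ltnS ltn_quotient.
- exact: quotient_pgroup.
- apply: (fintype.subset_trans _ (quotient_norms M nN)); apply/fintype.subsetP=> x _.
  by have [y My ->] := cosetP x; rewrite mem_quotient ?inE.
- by move=> s t /alphaC; rewrite /= => ->.
- by rewrite /= -qV -!qM qN.
pose alpha2 g := repr (beta1 g).
have qa2 g : q (alpha2 g) = beta1 g by apply: coset_reprK.
have [|g h|C' [beta [betaC betaM betaa]]] :=
    abelem_lift p_prime i0 abelM nM (C := C1) (alpha := alpha2).
- by move=> s t /beta1C; rewrite /alpha2 => ->.
- apply: coset_idr; first exact: NM.
  by rewrite -/(q _) !qM qV !qa2 beta1M mulgV.
exists C', beta; split=> // g.
rewrite -(mulgKV (alpha2 g) (beta g)) -mulgA; apply: groupM.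
  by apply: (fintype.subsetP sMN); apply: betaa.
by rewrite -qN qM qV qa2.
Qed.

(** * Congruence subgroups *)

Section FiniteRing.
Variables (Q : comNzRingType) (s : seq Q) (sP : forall x, x \in s).

(** A copy of [Q] indexed by the proof that [s] exhausts it, which carries the structures needed for
    its invertible matrices to form a finite group. *)
Definition finite_ring & (forall x, x \in s) : Type := Q.
Local Notation T := (finite_ring sP).

HB.instance Definition _ := GRing.ComNzRing.on T.

Fact finite_ring_pickleK : pcancel (fun x : T => index (x : Q) s) (fun n => onth s n).
Proof. by move=> x; rewrite /= onthE (nth_map (x : Q)) ?nth_index ?index_mem ?sP. Qed.
HB.instance Definition _ := Choice_isCountable.Build T finite_ring_pickleK.

Fact finite_ring_enumP : Finite.axiom (undup s : seq T).
Proof.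
move=> x; have := count_uniq_mem (x : Q) (undup_uniq s).
by rewrite mem_undup sP.
Qed.
HB.instance Definition _ := isFinite.Build T finite_ring_enumP.

Let inv (x : T) : T := if pselect (exists y : T, y * x = 1) is left e then sval (cid e) else x.

Fact finite_ring_mulV : {in [pred x : T | `[< exists y : T, y * x = 1 >]], left_inverse 1 inv *%R}.
Proof.
move=> x xU; have ex : exists y : T, y * x = 1 by apply/asboolP.
rewrite /inv.
by case: pselect => [e|nex]; [apply: (svalP (cid e))|case: (nex ex)].
Qed.
Fact finite_ring_unitP (x y : T) : y * x = 1 -> [pred x : T | `[< exists y : T, y * x = 1 >]] x.
Proof. by move=> yx; apply/asboolP; exists y. Qed.
Fact finite_ring_inv_out : {in [predC [pred x : T | `[< exists y : T, y * x = 1 >]]], inv =1 id}.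
Proof.
move=> x xU; have nex : ~ exists y : T, y * x = 1 by apply/asboolPn.
rewrite /inv.
by case: pselect => [e|//]; case: (nex e).
Qed.
HB.instance Definition _ := GRing.ComNzRing_hasMulInverse.Build T
  finite_ring_mulV finite_ring_unitP finite_ring_inv_out.

Lemma finite_ring_exists : exists (R : finComUnitRingType) (j : {rmorphism Q -> R}), bijective j.
Proof. by exists T, (idfun : Q -> Q); exists idfun. Qed.

End FiniteRing.

Section CongruenceSubgroup.
Variables (M : finUnitRingType) (D : {set M}).
Hypotheses (D0 : 0 \in D) (DD : forall x y, x \in D -> y \in D -> x + y \in D).
Hypotheses (DMl : forall a x, x \in D -> a * x \in D).
Hypotheses (DMr : forall a x, x \in D -> x * a \in D).
Hypothesis DU : forall x, x \in D -> 1 + x \is a GRing.unit.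

Definition congruence_units : {set {unit M}} := [set u | val u - 1 \in D]%SET.

Fact congruence_units_group : group_set congruence_units.
Proof.
apply/group_setP; split=> [|u v]; first by rewrite inE subrr.
rewrite !inE => uD vD; rewrite FinRing.val_unitM.
have -> : val u * val v - 1 = (val u - 1) * val v + (val v - 1).
  by rewrite mulrBl mul1r addrA subrK.
by apply: DD => //; apply: DMr.
Qed.
Canonical congruence_units_groupType := Group congruence_units_group.

Lemma congruence_units_norm : [set: {unit M}] \subset ('N(congruence_units))%g.
Proof.
apply/fintype.subsetP=> x _; rewrite inE; apply/fintype.subsetP=> _ /imsetP[u uD ->].
move: uD; rewrite !inE conjgE !FinRing.val_unitM FinRing.val_unitV => uD.
have -> : (val x)^-1 * (val u * val x) - 1 = (val x)^-1 * ((val u - 1) * val x).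
  by rewrite mulrBl mulrBr mul1r mulVr // (valP x).
by apply: DMl; apply: DMr.
Qed.

(** The map u |-> u - 1 is a bijection onto the additive group D, which is killed by p^n; by
    Cauchy's theorem no other prime divides its order. *)
Lemma congruence_units_pgroup (p n : nat) : prime p ->
  (p ^ n)%:R = 0 :> M -> (p.-group congruence_units)%g.
Proof.
move=> p_prime pn0.
have DN x : x \in D -> - x \in D by rewrite -mulN1r; apply: DMl.
have Dg : group_set (D : {set M}).
  by apply/group_setP; split=> // x y; apply: DD.
have cardD : #|congruence_units| = #|Group Dg|.
  rewrite -(card_in_imset (f := fun u : {unit M} => val u - 1)); last first.
    by move=> u v _ _ /addIr/val_inj.
  apply: eq_card => x; apply/imsetP/idP => [[u + ->]|xD]; first by rewrite inE.
  by exists (FinRing.unit M (DU xD)); rewrite ?inE /= addrC addKr.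
rewrite /pgroup cardD; apply/pgroupP => q q_prime qD.
have [x xD xq] := Cauchy q_prime qD.
have : (q %| p ^ n)%N.
  rewrite -xq order_dvdn; apply/eqP; transitivity (x *+ (p ^ n)%N) => //.
  by rewrite -mulr_natl pn0 mul0r.
by rewrite Euclid_dvdX // dvdn_prime2 // => /andP[/eqP -> _]; rewrite inE.
Qed.

End CongruenceSubgroup.

Section LiftStep.
Variables (A : comNzRingType) (Omega : closedFieldType).
Variable xbar : {rmorphism A -> Omega}.
Variables (p : nat) (p_prime : prime p) (i0 : {rmorphism 'F_p -> A}).
Variables (S L : comUnitRingType) (pr : {rmorphism S -> L}).
Hypothesis pr_local : forall x, pr x \is a GRing.unit -> x \is a GRing.unit.
Variables (I K : set S).
Hypotheses (idI : is_ideal I) (idK : is_ideal K).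
Hypotheses (KI : forall x, K x -> I x) (I_ker : forall x, I x -> pr x = 0).
Hypothesis K_finite : exists s : seq S, forall x, exists2 y, y \in s & K (x - y).
Variables (n d : nat).
Hypothesis Kpn : K (p ^ n)%:R.

Definition cong_mx (J : set S) (X Y : 'M[S]_d.+1) := forall i j, J ((X - Y) i j).

(** Passage from S / I to S / K. This covers both kinds of surjection: [I] is the kernel of [pr] at
    first and a power of p afterwards. The size is [d.+1] because square matrices form a nonzero
    ring only in positive size. *)
Lemma lift_step (C : finite_etale A) (r : pi1 xbar -> 'M[S]_d.+1) :
  factors_through C r -> (forall g, map_mx pr (r g) \in unitmx) ->
  (forall g h, cong_mx I (r (pi1_mul g h)) (r g *m r h)) ->
  exists (C' : finite_etale A) (r' : pi1 xbar -> 'M[S]_d.+1),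
  [/\ factors_through C' r',
      forall g h, cong_mx K (r' (pi1_mul g h)) (r' g *m r' h)
    & forall g, cong_mx I (r' g) (r g)].
Proof.
move=> rC r_unit rM.
have [I0 ID IM] := idI.
have K1 : ~ K 1 by move/KI/I_ker/eqP; rewrite rmorph1 oner_eq0.
have [Q [q0 [q0S kerq0]]] := quotient_exists idK K1.
have [s sP] := K_finite.
have Qs x : x \in map q0 s.
  have [y <-] := q0S x; have [z zs Kyz] := sP y.
  apply/mapP; exists z => //; apply/eqP.
  by rewrite -subr_eq0 -rmorphB; apply/eqP/kerq0.
have [R [j [j' jK j'K]]] := finite_ring_exists Qs.
pose q : {rmorphism S -> R} := (j \o q0)%FUN.
have kerq x : q x = 0 <-> K x.
  rewrite -kerq0; split=> [|/= ->]; last by rewrite rmorph0.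
  by move=> qx; rewrite -(jK (q0 x)) [j _]qx -[RHS](jK 0) rmorph0.
have qS y : exists x, q x = y.
  by have [x xy] := q0S (j' y); exists x; rewrite /= xy.
have [lft lftK] := choice qS.
pose IR y := exists2 x, I x & q x = y.
have IRq x : IR (q x) -> I x.
  move=> [x' Ix' e]; rewrite -(subrK x' x); apply: ID => //; apply/KI/kerq.
  by rewrite rmorphB e subrr.
pose D := [set X : 'M[R]_d.+1 | [forall i, forall l, `[< IR (X i l) >]]]%SET.
have DP (X : 'M[R]_d.+1) : reflect (forall i l, IR (X i l)) (X \in D).
  rewrite inE; apply: (iffP forallP) => [H i l|H i].
    by have /forallP/(_ l)/asboolP := H i.
  by apply/forallP=> l; apply/asboolP.
have IR0 : IR 0 by exists 0; rewrite ?rmorph0.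
have IRD x y : IR x -> IR y -> IR (x + y).
  by move=> [x' Ix' <-] [y' Iy' <-]; exists (x' + y'); rewrite ?rmorphD //; apply: ID.
have IRM x y : IR y -> IR (x * y).
  move=> [y' Iy' <-]; have [x' <-] := qS x.
  by exists (x' * y'); rewrite ?rmorphM //; apply: IM.
have D0 : 0 \in D by apply/DP=> i l; rewrite mxE.
have DD (X Y : 'M[R]_d.+1) : X \in D -> Y \in D -> X + Y \in D.
  by move=> /DP XD /DP YD; apply/DP=> i l; rewrite mxE; apply: IRD.
have DMl (X Y : 'M[R]_d.+1) : Y \in D -> X * Y \in D.
  move=> /DP YD; apply/DP=> i l; rewrite mxE.
  by apply: (big_ind IR) => // k _; apply: IRM.
have DMr (X Y : 'M[R]_d.+1) : Y \in D -> Y * X \in D.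
  move=> /DP YD; apply/DP=> i l; rewrite mxE.
  by apply: (big_ind IR) => // k _; rewrite mulrC; apply: IRM.
have unit_pr (X : 'M[S]_d.+1) : map_mx pr X \in unitmx -> map_mx q X \is a GRing.unit.
  move=> prX; change (map_mx q X \in unitmx).
  rewrite unitmxE det_map_mx rmorph_unit //; apply: pr_local.
  by rewrite -det_map_mx -unitmxE.
(* Lift X to a matrix with entries in I: adding 1 gives a matrix that [pr] sends to 1, hence an
   invertible one as [pr] detects units. *)
have DU (X : 'M[R]_d.+1) : X \in D -> 1 + X \is a GRing.unit.
  move=> /DP XD; have [X' X'I X'E] : exists2 X' : 'M[S]_d.+1,
      (forall i l, I (X' i l)) & map_mx q X' = X.
    have XDl i : exists f : 'I_d.+1 -> S, forall l, I (f l) /\ q (f l) = X i l.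
      have [f fP] := choice (fun l => let: ex_intro2 x Ix qx := XD i l in
        ex_intro (fun x => I x /\ q x = X i l) x (conj Ix qx)).
      by exists f.
    have [F FP] := choice XDl.
    exists (\matrix_(i, l) F i l) => [i l|]; first by rewrite mxE; apply: (FP i l).1.
    by apply/matrixP=> i l; rewrite !mxE (FP i l).2.
  have -> : 1 + X = map_mx q (1 + X') by rewrite map_mxD map_mx1 X'E.
  apply: unit_pr; rewrite map_mxD map_mx1.
  have -> : map_mx pr X' = 0 by apply/matrixP=> i l; rewrite !mxE I_ker.
  by rewrite addr0 unitmx1.
pose N : {group {unit 'M[R]_d.+1}} := congruence_units_groupType D0 DD DMr.
have pn0 : (p ^ n)%:R = 0 :> 'M[R]_d.+1.
  have /kerq qpn := Kpn.
  by rewrite -scaler_nat -(rmorph_nat q) qpn scale0r.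
have pN : (p.-group N)%g := congruence_units_pgroup D0 DD DMl DU p_prime pn0.
have nN := congruence_units_norm DMl DMr : [set: {unit 'M[R]_d.+1}] \subset ('N(N))%g.
pose alpha g : {unit 'M[R]_d.+1} := FinRing.unit _ (unit_pr _ (r_unit g)).
have alphaE g : val (alpha g) = map_mx q (r g) by [].
have Nu (u v : {unit 'M[R]_d.+1}) :
    (u * v^-1 \in N)%g = (val u - val v \in D).
  have vU := valP v; rewrite inE FinRing.val_unitM FinRing.val_unitV.
  apply/idP/idP => H.
    have -> : val u - val v = (val u * (val v)^-1 - 1) * val v.
      by rewrite mulrBl mul1r mulrVK.
    exact: (DMr _ _ H).
  have -> : val u * (val v)^-1 - 1 = (val u - val v) * (val v)^-1.
    by rewrite mulrBl mulrV.
  exact: (DMr _ _ H).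
have congD (X Y : 'M[S]_d.+1) : cong_mx I X Y <-> map_mx q X - map_mx q Y \in D.
  rewrite -map_mxB; split=> [H|/DP H i l].
    by apply/DP=> i l; rewrite mxE; exists ((X - Y) i l).
  by apply: IRq; have := H i l; rewrite mxE.
have congDV (X Y : 'M[S]_d.+1) : map_mx q X - map_mx q Y \in D -> map_mx q Y - map_mx q X \in D.
  by move=> H; rewrite -opprB -mulN1r; apply: DMl.
have alphaC : factors_through C alpha.
  by move=> g h gh; apply: val_inj; rewrite !alphaE (rC g h gh).
have alphaM g h : (alpha g * alpha h * (alpha (pi1_mul g h))^-1 \in N)%g.
  rewrite Nu FinRing.val_unitM !alphaE.
  have -> : map_mx q (r g) * map_mx q (r h) = map_mx q (r g *m r h) by rewrite map_mxM.
  exact/congDV/congD.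
have [C' [beta [betaC betaM betaN]]] := pgroup_lift p_prime i0 pN nN alphaC alphaM.
(* Any set-theoretic lift from S / K to S will do, since the conclusion is modulo K. *)
exists C', (fun g => map_mx lft (val (beta g))).
have lftE (X : 'M[R]_d.+1) : map_mx q (map_mx lft X) = X.
  by apply/matrixP=> i l; rewrite !mxE lftK.
split.
- by move=> g h gh; rewrite (betaC g h gh).
- move=> g h i l; apply/kerq.
  have : map_mx q (map_mx lft (val (beta (pi1_mul g h))) -
     map_mx lft (val (beta g)) *m map_mx lft (val (beta h))) = 0.
    by rewrite map_mxB map_mxM !lftE betaM FinRing.val_unitM subrr.
  by move/matrixP/(_ i l); rewrite !mxE.
- by move=> g; apply/congD; rewrite lftE -alphaE -Nu.
Qed.

End LiftStep.

(** * Finite algebras over the p-adic integers *)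

Section PadicIntegers.
Variables (p : nat) (p_prime : prime p).
Local Notation Zp := (padic_int p).

Lemma eq_Zp_nat (m a b : nat) : (1 < m)%N -> a = b %[mod m] ->
  a%:R = b%:R :> 'Z_m.
Proof. by move=> m_gt1 ab; apply: val_inj; rewrite /= !val_Zp_nat. Qed.

Let pX_gt1 k : (1 < p ^ k.+1)%N.
Proof. by rewrite -(exp1n k.+1) ltn_exp2r // prime_gt1. Qed.

Definition padic_coord k (x : Zp) : 'Z_(p ^ k.+1) := x k.

Fact padic_coord_zmod k : zmod_morphism (padic_coord k).
Proof. by []. Qed.
Fact padic_coord_monoid k : monoid_morphism (padic_coord k).
Proof. by []. Qed.
HB.instance Definition _ k :=
  GRing.isZmodMorphism.Build Zp _ (padic_coord k) (padic_coord_zmod k).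
HB.instance Definition _ k :=
  GRing.isMonoidMorphism.Build Zp _ (padic_coord k) (padic_coord_monoid k).

Lemma padic_coherent_add (x : Zp) k m : x (k + m)%N = x k %[mod p ^ k.+1].
Proof.
elim: m => [|m IHm]; first by rewrite addn0.
rewrite -IHm addnS -[in RHS](@modn_dvdm (p ^ (k + m).+1)) ?dvdn_exp2l ?ltnS ?leq_addr //.
by rewrite -padic_coherent modn_dvdm // dvdn_exp2l // ltnS leq_addr.
Qed.

Lemma padic_coord_pX k (y : Zp) : padic_coord k (p%:R ^+ k.+1 * y) = 0.
Proof.
rewrite rmorphM rmorphXn rmorph_nat -natrX.
by rewrite (@eq_Zp_nat (p ^ k.+1) (p ^ k.+1) 0%N) ?mul0r // modnn mod0n.
Qed.

Lemma padic_separated (x : Zp) : (forall n, exists y, x = p%:R ^+ n * y) -> x = 0.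
Proof.
move=> xP; apply: padic_int_eq => k; have [y ->] := xP k.+1.
exact: padic_coord_pX.
Qed.

Lemma padic_div (x : Zp) n :
  exists y : Zp, x = (x n %% p ^ n)%N%:R + p%:R ^+ n * y.
Proof.
(* As [x (k + n)] is known modulo p^(k+n+1), its quotient by p^n is known modulo p^(k+1), the
   precision of coordinate [k]. *)
pose yv k : 'Z_(p ^ k.+1) := (x (k + n) %/ p ^ n)%N%:R.
have yC k : yv k.+1 = yv k %[mod p ^ k.+1].
  rewrite /yv !val_Zp_nat // modn_mod modn_dvdm ?dvdn_exp2l //.
  rewrite !modn_divl -expnD; congr (_ %/ _)%N.
  by rewrite addSn padic_coherent.
exists (PadicInt yC); apply: padic_int_eq => k.
rewrite -[RHS]/(padic_coord k ((x n %% p ^ n)%N%:R + p%:R ^+ n * PadicInt yC)).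
rewrite rmorphD rmorphM rmorphXn !rmorph_nat -[X in _ + _ * X]/(yv k).
rewrite /yv -natrX -natrM -natrD -[LHS]natr_Zp.
apply: eq_Zp_nat => //; rewrite -(padic_coherent_add x k n); congr (_ %% _)%N.
have -> : (x n %% p ^ n = x (k + n) %% p ^ n)%N.
  have /(congr1 (modn^~ (p ^ n)%N)) := padic_coherent_add x n k.
  by rewrite (addnC n) !modn_dvdm ?dvdn_exp2l.
by rewrite [RHS]addnC [X in _ = (X + _)%N]mulnC -divn_eq.
Qed.

Lemma padic_series (c : nat -> Zp) :
  exists z : Zp, forall n, exists y, z = \sum_(i < n) p%:R ^+ i * c i + p%:R ^+ n * y.
Proof.
pose S n := \sum_(i < n) p%:R ^+ i * c i.
have SS n : S n.+1 = S n + p%:R ^+ n * c n by rewrite /S big_ord_recr.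
(* Coordinate [k] is modulo p^(k+1), where all terms of index above [k] vanish. *)
pose zv k := S k.+1 k.
have zC k : zv k.+1 = zv k %[mod p ^ k.+1].
  rewrite /zv padic_coherent; congr (modn (nat_of_ord _) _).
  rewrite -[LHS]/(padic_coord k (S k.+2)) SS rmorphD.
  by rewrite [X in _ + X](padic_coord_pX k) addr0.
exists (PadicInt zC) => n; have [y yE] := padic_div (PadicInt zC - S n) n.
exists y; rewrite -/(S n); suff a0 : ((PadicInt zC - S n)%R n %% p ^ n)%N = 0%N.
  by rewrite -[p%:R ^+ n * y]add0r -{1}[0](mulr0n 1) -{1}a0 -yE addrC subrK.
have -> : (PadicInt zC - S n) n = padic_coord n (p%:R ^+ n * c n).
  rewrite -[LHS]/(S n.+1 n - S n n) -[S n.+1 n]/(padic_coord n (S n.+1)) SS rmorphD.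
  by rewrite addrC addKr.
rewrite rmorphM rmorphXn rmorph_nat -natrX -[X in _ * X]natr_Zp -natrM.
by rewrite val_Zp_nat // modn_dvdm ?dvdn_exp2l // modnMr.
Qed.

(** The inverse is the sum of the geometric series; the identity is checked modulo every p^n. *)
Lemma padic_unit_sub1 (y : Zp) : exists w, w * (1 - p%:R * y) = 1.
Proof.
have [z zP] := padic_series (fun i => y ^+ i); exists z.
apply/eqP; rewrite -subr_eq0; apply/eqP/padic_separated => n.
have [u ->] := zP n; exists (u * (1 - p%:R * y) - y ^+ n).
under eq_bigr => i _ do rewrite -exprMn.
have := subrX1 (p%:R * y) n; rewrite exprMn => e.
have SD : (\sum_(i < n) (p%:R * y) ^+ i) * (1 - p%:R * y) = 1 - p%:R ^+ n * y ^+ n.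
  by rewrite mulrC -opprB mulNr -e opprB.
rewrite mulrDl SD [RHS]mulrBr [X in _ = X - _]mulrA.
by rewrite [LHS]addrAC (addrAC 1) subrr add0r [LHS]addrC.
Qed.

Lemma padic_unit_or_div (x : Zp) : (exists w, w * x = 1) \/ exists y, x = p%:R * y.
Proof.
have [y xE] := padic_div x 1; rewrite expr1 expn1 in xE.
set a := (x 1%N %% p)%N in xE.
have [a0|a_gt0] := posnP a; first by right; exists y; rewrite xE a0 add0r.
(* Bézout gives b a = t p + 1, so that b x = 1 + p (t + b y) is invertible by the geometric
   series. *)
left; have [b t e _] := egcdnP p a_gt0.
have cop : coprime a p.
  rewrite coprime_sym prime_coprime // gtnNdvd // ltn_pmod //.
  exact: prime_gt0.
rewrite (eqP (cop : gcdn a p == 1%N)) in e.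
have [w we] := padic_unit_sub1 (- (t%:R + b%:R * y)).
exists (w * b%:R); rewrite -mulrA -[RHS]we; congr (_ * _).
rewrite xE mulrDr -natrM e natrD natrM mulrN opprK mulrDr [RHS]addrA.
by rewrite (addrC 1) mulrCA (mulrC t%:R).
Qed.

Lemma padic_mulp_inj (x : Zp) : p%:R * x = 0 -> x = 0.
Proof.
move=> px; apply: padic_int_eq => k; apply: val_inj => /=.
(* Division by p costs one digit: coordinate [k] of x is read off coordinate [k.+1] of p x. *)
have /(congr1 (padic_coord k.+1)) := px.
rewrite rmorphM rmorph_nat rmorph0 -[X in _ * X]natr_Zp -natrM.
move=> /(congr1 val) /=; rewrite val_Zp_nat // => e.
have : (p ^ k.+2 %| p * x k.+1)%N by apply/eqP.
have := padic_coherent x k; move: (nat_of_ord (x k.+1)) => a.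
rewrite (expnS p k.+1) dvdn_pmul2l ?prime_gt0 // => ea /eqP; rewrite ea modn_small //.
by rewrite -[X in (_ < X)%N](Zp_cast (pX_gt1 k)) ltn_ord.
Qed.

End PadicIntegers.

Section RegularTensor.
Variables (R : comNzRingType) (M : lmodType R).

Definition regular_scale (a : R^o) (m : M) : M := (a : R) *: m.

Fact regular_scale_bilinear : bilinear_for
  (GRing.Scale.Law.clone _ _ *:%R _) (GRing.Scale.Law.clone _ _ *:%R _)
  regular_scale.
Proof.
split=> [m a b c|a b m m'] /=; first by rewrite /regular_scale scalerDl scalerA.
by rewrite /regular_scale scalerDr !scalerA mulrC.
Qed.
HB.instance Definition _ := bilinear_isBilinear.Build R R^o M M _ _ regular_scale
  regular_scale_bilinear.

Lemma regular_scale_tensor :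
  is_tensor_product (regular_scale : {bilinear R^o -> M -> M}).
Proof.
move=> P b.
exists (b 1 : {linear M -> P}) => [a m|g' g'E m]; last first.
  by have /= := g'E 1 m; rewrite /regular_scale scale1r.
rewrite /regular_scale linearZ /=.
have {2}-> : a = (a : R) *: (1 : R^o) by rewrite /GRing.scale /= mulr1.
by rewrite linearZl_LR.
Qed.

Definition scale_by (a : R) (m : M) : M := a *: m.
Fact scale_by_linear a : linear (scale_by a).
Proof. by move=> k u v; rewrite /scale_by scalerDr !scalerA mulrC. Qed.
HB.instance Definition _ a := GRing.isLinear.Build R M M _ (scale_by a) (scale_by_linear a).

End RegularTensor.

(** Tensor the injection [a] of R into itself with M, taking M as the tensor product of R and M. *)
Lemma flat_regular (R : comNzRingType) (M : lmodType R) (a : R) :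
  flat_module M -> (forall x, a * x = 0 -> x = 0) -> injective (scale_by a : M -> M).
Proof.
move=> flatM aI; pose f : {linear R^o -> R^o} := scale_by a.
have fI : injective f.
  move=> x y; rewrite /= /scale_by /GRing.scale /= => /eqP.
  by rewrite -subr_eq0 -mulrBr => /eqP/aI/eqP; rewrite subr_eq0 => /eqP.
apply: (flatM _ _ f fI _ _ _ _ (@regular_scale_tensor R M) (@regular_scale_tensor R M)
  (scale_by a : {linear M -> M})) => x m /=.
by rewrite /scale_by /regular_scale scalerA.
Qed.

Section PadicModules.
Variables (p : nat) (p_prime : prime p) (M : comAlgType (padic_int p)).
Local Notation Zp := (padic_int p).

Lemma scale_pX n (x : M) : (p%:R ^+ n : Zp) *: x = p%:R ^+ n * x.
Proof. by rewrite -!natrX scaler_nat mulr_natl. Qed.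

Definition pX_ideal n : set M := fun x => exists y, x = p%:R ^+ n * y.

Lemma is_ideal_pX n : is_ideal (pX_ideal n).
Proof.
split=> [|_ _ [y ->] [y' ->]|a _ [y ->]]; first by exists 0; rewrite mulr0.
  by exists (y + y'); rewrite mulrDr.
by exists (a * y); rewrite mulrCA.
Qed.

Lemma pX_idealS m n x : (m <= n)%N -> pX_ideal n x -> pX_ideal m x.
Proof.
by move=> mn [y ->]; exists (p%:R ^+ (n - m) * y); rewrite mulrA -exprD subnKC.
Qed.

Lemma common_valuation r (c : 'I_r -> Zp) i0 : c i0 != 0 ->
  exists n (y : 'I_r -> Zp), (forall i, c i = p%:R ^+ n * y i) /\
    exists i w, w * y i = 1.
Proof.
move=> c0; pose P n := `[< exists i, ~ exists y, c i = p%:R ^+ n * y >].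
have exP : exists n, P n.
  apply: contrapT => nP; move/eqP: c0; apply; apply: (padic_separated p_prime) => n.
  apply: contrapT => ny; apply: nP; exists n; apply/asboolP.
  by exists i0.
(* Since p^0 divides everything, the least power not dividing all the [c i] is a successor [n.+1]; a
   [y i] not divisible by p is then a unit. *)
have [[|n] /asboolP[i ni] n_min] := ex_minnP exP.
  by case: ni; exists (c i); rewrite expr0 mul1r.
have cn l : exists y, c l = p%:R ^+ n * y.
  apply: contrapT => ny; have /n_min : P n by apply/asboolP; exists l.
  by rewrite ltnn.
have [y yE] := choice cn; exists n, y; split=> //.
exists i; have [//|[u yu]] := padic_unit_or_div p_prime (y i).
by case: ni; exists u; rewrite yE yu mulrA exprSr.
Qed.

Hypothesis M_fin : finite_module M.

Lemma finite_spanning : exists r (t : 'I_r -> M),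
  forall v, exists c : 'I_r -> Zp, v = \sum_i c i *: t i.
Proof.
have [s sP] := M_fin; exists (size s), (fun i => s`_i) => v.
by have [c ->] := sP v; exists (fun i => c i).
Qed.

Lemma torsion_free_basis : (forall x : M, p%:R * x = 0 -> x = 0) ->
  exists r (t : 'I_r -> M), (forall v, exists c : 'I_r -> Zp, v = \sum_i c i *: t i) /\
    forall c : 'I_r -> Zp, \sum_i c i *: t i = 0 -> forall i, c i = 0.
Proof.
move=> tf; have tfX n x : p%:R ^+ n * x = 0 :> M -> x = 0.
  by elim: n => [|n IHn]; rewrite ?expr0 ?mul1r // exprS -mulrA => /tf.
have [r [t tP]] := finite_spanning; elim: r t tP => [|r IHr] t tP.
  by exists 0%N, t; split=> // c _ [].
have [free|nfree] := pselect (forall c : 'I_r.+1 -> Zp, \sum_i c i *: t i = 0 -> forall i, c i = 0).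
  by exists r.+1, t.
have [c [c0 [i1 ci1]]] : exists c : 'I_r.+1 -> Zp, \sum_i c i *: t i = 0 /\ exists i, c i != 0.
  apply: contrapT => nc; apply: nfree => c c0 i; apply/eqP.
  by apply: contra_notT nc => ci; exists c; split=> //; exists i.
have [n [y [cy [i [w wy]]]]] := common_valuation ci1.
have y0 : \sum_i y i *: t i = 0.
  apply: (tfX n); rewrite -[RHS]c0 mulr_sumr; apply: eq_bigr => l _.
  by rewrite cy -scalerA scale_pX.
apply: (IHr (t \o lift i)) => v; have [a ->] := tP v.
have ti : t i = - \sum_l (w * y (lift i l)) *: t (lift i l).
  apply/eqP; rewrite -addr_eq0; apply/eqP; transitivity (w *: \sum_i y i *: t i).
    rewrite [in RHS](bigD1_ord i) //= scalerDr scalerA wy scale1r scaler_sumr.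
    by congr (_ + _); apply: eq_bigr => l _; rewrite scalerA.
  by rewrite y0 scaler0.
exists (fun l => a (lift i l) - a i * (w * y (lift i l))).
rewrite (bigD1_ord i) //= ti scalerN scaler_sumr -sumrN addrC -big_split /=.
by apply: eq_bigr => l _; rewrite scalerBl scalerA.
Qed.

Lemma pX_separated : (forall x : M, p%:R * x = 0 -> x = 0) ->
  forall x, (forall n, pX_ideal n x) -> x = 0.
Proof.
move=> /torsion_free_basis[r [t [tP tfree]]] x xP; have [c xE] := tP x.
rewrite xE big1 // => i _; suff -> : c i = 0 by rewrite scale0r.
apply: (padic_separated p_prime) => n; have [y yE] := xP n; have [e ye] := tP y.
exists (e i); apply/eqP; rewrite -subr_eq0; apply/eqP.
apply: (tfree (fun i => c i - p%:R ^+ n * e i)).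
under eq_bigr => l _ do rewrite scalerBl -scalerA scale_pX.
by rewrite sumrB -mulr_sumr -xE -ye yE subrr.
Qed.

(** Expand each increment, divided by its power of p, on a finite spanning family, and sum every
    coordinate as a p-adic series. *)
Lemma pX_complete (u : nat -> M) : (forall n, pX_ideal n (u n.+1 - u n)) ->
  exists x, forall n, pX_ideal n (x - u n).
Proof.
have [r [t tP]] := finite_spanning; move=> uP.
have [v vE] := choice uP.
have [c cE] := choice (fun n => tP (v n)).
have [z zP] := choice (fun i => padic_series p_prime (c ^~ i)).
exists (u 0 + \sum_i z i *: t i) => n.
have [y yE] := choice (fun i => zP i n).
exists (\sum_i y i *: t i).
have un : u n - u 0 = \sum_i (\sum_(k < n) p%:R ^+ k * c k i) *: t i.
  rewrite -(telescope_sumr _ (leq0n n)) big_mkord.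
  under [RHS]eq_bigr => i _ do rewrite scaler_suml.
  rewrite exchange_big; apply: eq_bigr => k _ /=.
  rewrite vE cE mulr_sumr; apply: eq_bigr => i _.
  by rewrite -scale_pX scalerA.
have -> : u 0 + \sum_i z i *: t i - u n = \sum_i z i *: t i - (u n - u 0).
  by rewrite opprB addrA (addrC (u 0)).
rewrite un.
rewrite mulr_sumr -sumrB; apply: eq_bigr => i _.
by rewrite -scale_pX scalerA -scalerBl {1}yE [X in X *: _]addrC addKr.
Qed.

Lemma pX_finite_quotient n :
  exists s : seq M, forall x, exists2 y, y \in s & pX_ideal n (x - y).
Proof.
have [r [t tP]] := finite_spanning.
exists [seq \sum_i (f i : nat)%:R *: t i | f : {ffun 'I_r -> 'I_(p ^ n)}] => x.
have [c ->] := tP x.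
have [y yE] := choice (fun i => padic_div p_prime (c i) n).
have lta i : (c i n %% p ^ n < p ^ n)%N by rewrite ltn_mod expn_gt0 prime_gt0.
pose f : {ffun 'I_r -> 'I_(p ^ n)} := [ffun i => Ordinal (lta i)].
exists (\sum_i (f i : nat)%:R *: t i).
  apply: (map_f (fun f : {ffun 'I_r -> 'I_(p ^ n)} => \sum_i (f i : nat)%:R *: t i)).
  by rewrite mem_enum.
exists (\sum_i y i *: t i); rewrite -sumrB mulr_sumr; apply: eq_bigr => i _.
by rewrite -scalerBl ffunE /= {1}yE [X in X *: _]addrC addKr -scale_pX scalerA.
Qed.

End PadicModules.

Lemma maximal_ideal_above (R : comNzRingType) (J : set R) :
  is_ideal J -> ~ J 1 -> exists m, maximal_ideal m /\ forall x, J x -> m x.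
Proof.
move=> idJ J1; have [J0 JD JM] := idJ.
(* The union with [J] accounts for the empty chain, whose union is the empty set and not an
   ideal. *)
pose P (X : set R) := is_ideal (J `|` X)%classic /\ ~ (J `|` X)%classic 1.
have [F FP Ftot|m0 [[idm m1] m_max]] := @Zorn_bigcup R P.
  have join a b : (J `|` \bigcup_(X in F) X)%classic a ->
      (J `|` \bigcup_(X in F) X)%classic b ->
      (J a /\ J b) \/ exists2 X, F X & (J `|` X)%classic a /\ (J `|` X)%classic b.
    move=> [Ja|[X FX Xa]] [Jb|[Y FY Yb]].
    - by left.
    - by right; exists Y => //; split; [left|right].
    - by right; exists X => //; split; [right|left].
    - by right; have [XY|YX] := Ftot _ _ FX FY; [exists Y|exists X] => //;
        split; right => //; [apply: XY|apply: YX].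
  split; last by move=> [//|[X FX X1]]; have [_] := FP _ FX; apply; right.
  split; first by left.
  - move=> a b aF bF; have [[Ja Jb]|[X FX [aX bX]]] := join a b aF bF.
      by left; apply: JD.
    have [[_ XD _] _] := FP _ FX; have [Jab|Xab] := XD _ _ aX bX; first by left.
    by right; exists X.
  - move=> r a [Ja|[X FX Xa]]; first by left; apply: JM.
    have [[_ _ XM] _] := FP _ FX.
    have [Jra|Xra] : (J `|` X)%classic (r * a) by apply: XM; right.
      by left.
    by right; exists X.
exists (J `|` m0)%classic; split; last by move=> x Jx; left.
split=> // B idB B1 mB; apply/seteqP; split=> // x Bx.
apply: contrapT => mx; apply: (m_max B).
  split=> [y my|Bm]; first by apply: mB; right.
  by apply: mx; right; apply: Bm.
rewrite /P; have -> : (J `|` B)%classic = B.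
  by apply/seteqP; split=> [y [Jy|//]|y By]; [apply: mB; left|right].
by split.
Qed.

Lemma local_ringP (R : comUnitRingType) : local_ring R -> exists m : set R,
  [/\ is_ideal m, ~ m 1, maximal_ideal m, forall x, x \isn't a GRing.unit -> m x
    & forall J, is_ideal J -> ~ J 1 -> forall x, J x -> m x].
Proof.
move=> [m [m_max m_uniq]]; exists m; have [idm m1 _] := m_max.
have below J : is_ideal J -> ~ J 1 -> forall x, J x -> m x.
  move=> idJ J1; have [m' [m'_max Jm']] := maximal_ideal_above idJ J1.
  by rewrite (m_uniq _ m'_max).
split=> // x xU; apply: (below (fun y => exists a, y = a * x)).
- split=> [|_ _ [a ->] [b ->]|r _ [a ->]]; first by exists 0; rewrite mul0r.
    by exists (a + b); rewrite mulrDl.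
  by exists (r * a); rewrite mulrA.
- by move=> [a a1]; move/negP: xU; apply; apply/unitrPr; exists a; rewrite mulrC -a1.
- by exists 1; rewrite mul1r.
Qed.

(** If x is not a unit, it lies in the maximal ideal, and so does the kernel of [f]. Then so does 1
    = y x + (1 - y x), where y maps to the inverse of [f x]. *)
Lemma local_surjection_unit (R S : comUnitRingType) (f : {rmorphism R -> S}) x :
  local_ring R -> f x \is a GRing.unit -> Defs.surjective f -> x \is a GRing.unit.
Proof.
move=> /local_ringP[m [[m0 mD mM] m1 _ mU below]] fxU fS.
apply: contraT => /mU mx; have [y fy] := fS (f x)^-1; case: m1.
have -> : 1 = y * x + (1 - y * x) by rewrite addrC subrK.
apply: mD; first exact: mM.
apply: (below (fun z => f z = 0)) => [||] /=.
- exact: is_ideal_ker.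
- by move/eqP; rewrite rmorph1 oner_eq0.
- by rewrite rmorphB rmorph1 rmorphM fy mulVr // subrr.
Qed.

(** If p were a unit, two of its powers would agree in the finite residue field, although 1 - p y is
    a unit for every p-adic integer y. So p is in the maximal ideal, and p^N = p^(N+1) c by the
    descending chain condition, where 1 - p c is a unit. *)
Lemma padic_p_nilpotent (p : nat) (p_prime : prime p)
    (L : comUnitAlgType (padic_int p)) :
  artinian L -> local_ring L -> finite_residue_field L ->
  exists n, p%:R ^+ n = 0 :> L.
Proof.
move=> L_art L_loc L_res.
have [m [[m0 mD mM] m1 m_max mU _]] := local_ringP L_loc.
have sub1U (y : padic_int p) : 1 - p%:R * y%:A \is a @GRing.unit L.
  have [w wy] := padic_unit_sub1 p_prime y; apply/unitrPr; exists w%:A.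
  have -> : 1 - p%:R * y%:A = (1 - p%:R * y)%:A :> L.
    by rewrite scalerBl scale1r -scalerA scaler_nat mulr_natl.
  by rewrite -[w%:A]/(GRing.in_alg L w) -[(1 - _)%:A]/(GRing.in_alg L _) -rmorphM mulrC wy rmorph1.
have mp : m p%:R.
  apply: contrapT => mp; have pU : p%:R \is a @GRing.unit L.
    by apply: contra_notT mp => /mU.
  pose coset (i : nat) := [set b : L | m (b - p%:R ^+ i)]%classic.
  have [i [j [ltij cij]]] : exists i j, (i < j)%N /\ coset i = coset j.
    apply: contrapT => nij; apply: infinite_nat.
    pose rg := range (fun a : L => [set b | m (b - a)]%classic).
    have inj_coset : {in (coset @^-1` rg)%classic &, injective coset}.
      move=> i j _ _ cij; apply: contrapT => /eqP; rewrite neq_ltn => /orP[] lt.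
        by apply: nij; exists i, j.
      by apply: nij; exists j, i.
    have -> : [set: nat]%classic = (coset @^-1` rg)%classic.
      by apply/seteqP; split=> // i _; exists (p%:R ^+ i).
    exact: finite_preimage inj_coset (L_res m m_max).
  have : m (p%:R ^+ i - p%:R ^+ j).
    by rewrite -[m _]/(coset j _) -cij /coset /= subrr.
  have -> : p%:R ^+ i - p%:R ^+ j = p%:R ^+ i * (1 - p%:R * (p%:R ^+ (j - i.+1))%:A) :> L.
    rewrite -[(p%:R ^+ _)%:A]/(GRing.in_alg L _) rmorphXn rmorph_nat -exprS mulrBr mulr1 -exprD.
    by rewrite -subSn // subSS subnKC // ltnW.
  move=> mx; apply: m1; set x := _ * _ in mx.
  have xU : x \is a GRing.unit by rewrite unitrM unitrX // sub1U.
  by rewrite -(mulVr xU); apply: mM.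
have [|n|N NP] := L_art (@pX_ideal p L); first exact: is_ideal_pX.
  by move=> x; apply: pX_idealS.
have [c pc] : @pX_ideal p L N.+1 (p%:R ^+ N).
  by rewrite (NP N.+1 (leqnSn N)); exists 1; rewrite mulr1.
exists N; have cU : 1 - p%:R * c \is a GRing.unit.
  apply: contraT => /mU mc; case: m1.
  have -> : 1 = (1 - p%:R * c) + c * p%:R by rewrite mulrC subrK.
  by apply: mD => //; apply: mM.
apply: (mulIr cU); rewrite mul0r mulrBr mulr1 mulrA -exprSr -pc subrr //.
Qed.

(** * Lifting representations *)

Lemma common_cover (A : comNzRingType) (Omega : closedFieldType)
    (xbar : {rmorphism A -> Omega}) (n : nat) (B : 'I_n -> finite_etale A) :
  exists C : finite_etale A, forall s t : pi1 xbar,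
    (forall y : fibre xbar C, s C y = t C y) ->
    forall i (y : fibre xbar (B i)), s _ y = t _ y.
Proof.
(* A point in the fibre of C is kept through the induction: it makes the next product nonzero and
   the projections onto both factors surjective on fibres. A covering with empty fibre imposes no
   condition. *)
suff [C [_ CP]] : exists C : finite_etale A, (exists y : fibre xbar C, True) /\
    forall s t : pi1 xbar, (forall y : fibre xbar C, s C y = t C y) ->
    forall i (y : fibre xbar (B i)), s _ y = t _ y by exists C.
elim: n B => [|n IHn] B.
  have [A_fin A_et] := trivial_etale A; exists (FiniteEtale A_fin A_et).
  split; last by move=> s t _ [].
  have xbarA (a : A) : (xbar : {rmorphism A^o -> Omega}) a%:A = xbar a.
    by rewrite /GRing.scale /= mulr1.
  by exists (@Fibre A Omega xbar A^o (xbar : {rmorphism A^o -> Omega}) xbarA).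
have [C0 [[y0 _] C0P]] := IHn (fun i => B (lift ord_max i)).
have [[z0 _]|noz] := pselect (exists z : fibre xbar (B ord_max), True); last first.
  exists C0; split; first by exists y0.
  move=> s t st i; have [[k ->]| -> y] := unlift_max i; first exact: C0P.
  by case: noz; exists y.
have [m [x [x' sep]]] := etale_separating (fet_etale (B ord_max)).
(* With no map to avoid, [adjoin_point] yields the full product of the two coverings. *)
have js : 'I_0 -> {lrmorphism B ord_max -> C0} by case.
have agree (y : fibre xbar C0) (z : fibre xbar (B ord_max)) (a : A) : y a%:A = z a%:A.
  by rewrite !fibre_over.
have nodis (T : comNzRingType) (h : C0 -> T) (k : B ord_max -> T) (l : 'I_0) :
  pairing x x' (h \o js l)%FUN k = 0 by case: l.
have [C [i [j [_ ext univ]]]] := adjoin_point sep (agree y0 z0) (nodis _ _ _).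
have point (y : fibre xbar C0) (z : fibre xbar (B ord_max)) :
    exists w : fibre xbar C, fibre_comp i w = y /\ fibre_comp j w = z.
  have [h [hi hj]] := univ _ _ _ (agree y z) (nodis _ _ _).
  have hA a : h a%:A = xbar a.
    have -> : a%:A = i a%:A by rewrite linearZ /= rmorph1.
    by rewrite hi fibre_over.
  by exists (Fibre hA); split; apply: fibre_eq => b /=; rewrite ?hi ?hj.
exists C; split; first by have [w _] := point y0 z0; exists w.
move=> s t st l; have [[k ->]| ->] := unlift_max l.
  apply: C0P => y; have [w [<- _]] := point y z0.
  by rewrite !pi1_natural st.
by move=> z; have [w [_ <-]] := point y0 z; rewrite !pi1_natural st.
Qed.

Section CongruenceCalculus.
Variables (S : comUnitRingType) (J : set S) (d : nat).
Hypothesis idJ : is_ideal J.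
Implicit Types X Y Z : 'M[S]_d.+1.

Lemma cong_mx_sym X Y : cong_mx J X Y -> cong_mx J Y X.
Proof.
have [_ _ JM] := idJ; move=> XY i j.
have -> : (Y - X) i j = -1 * (X - Y) i j by rewrite mulN1r !mxE opprB.
exact: JM.
Qed.

Lemma cong_mx_trans Y X Z : cong_mx J X Y -> cong_mx J Y Z -> cong_mx J X Z.
Proof.
have [_ JD _] := idJ; move=> XY YZ i j.
have -> : (X - Z) i j = (X - Y) i j + (Y - Z) i j by rewrite !mxE addrA subrK.
exact: JD.
Qed.

Lemma cong_mxM X X' Y Y' :
  cong_mx J X X' -> cong_mx J Y Y' -> cong_mx J (X *m Y) (X' *m Y').
Proof.
have [J0 JD JM] := idJ; move=> XX YY.
apply: (@cong_mx_trans (X *m Y')) => i j.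
  rewrite -mulmxBr mxE; apply: (big_ind J) => // k _; exact: JM.
rewrite -mulmxBl mxE; apply: (big_ind J) => // k _; rewrite mulrC; exact: JM.
Qed.

End CongruenceCalculus.

Lemma cong_mx_ker (S L : comUnitRingType) (pr : {rmorphism S -> L}) (d : nat)
    (X Y : 'M[S]_d.+1) :
  cong_mx (fun x => pr x = 0) X Y <-> map_mx pr X = map_mx pr Y.
Proof.
split=> [XY|/matrixP XY i j].
  apply/matrixP=> i j; rewrite !mxE; apply/eqP; rewrite -subr_eq0 -rmorphB.
  by have := XY i j; rewrite !mxE => ->.
by have := XY i j; rewrite !mxE rmorphB => ->; rewrite subrr.
Qed.

(** As p is nilpotent, the topology of L is discrete and [rho] is constant near the identity;
    multiplicativity carries this to every other element. *)
Lemma representation_factors (A : comNzRingType) (Omega : closedFieldType)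
    (xbar : {rmorphism A -> Omega}) (p d : nat) (L : comUnitAlgType (padic_int p))
    (rho : pi1 xbar -> 'M[L]_d) :
  (exists n, p%:R ^+ n = 0 :> L) -> continuous_representation rho ->
  exists C, factors_through C rho.
Proof.
move=> [N pN0] [rhoU rhoM rho_cont]; have [one oneE] := pi1_one_exists xbar.
have [|n [B BP]] := rho_cont one (fun X => X = rho one).
  exists (fun i j => [set b | b = rho one i j]%classic) => [i j|X XP].
    by exists N => // b [c ->]; rewrite pN0 mul0r addr0.
  by apply/matrixP=> i j; apply: XP.
have [C CP] := common_cover xbar B; exists C => s t st.
have [s' ss'] := pi1_inv_exists s.
have s's D y : s' D (s D y) = y by apply: (bij_inj (pi1_bij s D)); rewrite ss'.
have u1 : rho (pi1_mul s' t) = rho one.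
  apply: BP => i y /=; rewrite -(CP s t st) s's oneE //.
have -> : t = pi1_mul s (pi1_mul s' t) by apply: pi1_ext => D y /=; rewrite ss'.
rewrite rhoM u1 -rhoM; congr rho.
by apply: pi1_ext => D y /=; rewrite oneE.
Qed.

Theorem theorem6p2 (p : nat) (p_prime : prime p)
    (* X = Spec A, with a geometric point *)
    (A : comAlgType 'F_p) (A_smooth : smooth_algebra A)
    (Omega : closedFieldType) (xbar : {rmorphism A -> Omega})
    (L : comUnitAlgType (padic_int p)) (L_artinian : artinian L)
    (L_local : local_ring L) (L_residue : finite_residue_field L)
    (Lt : comUnitAlgType (padic_int p)) (Lt_finite : finite_module Lt)
    (Lt_flat : flat_module Lt) (Lt_local : local_ring Lt)
    (pr : {lrmorphism Lt -> L}) (pr_surj : Defs.surjective pr)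
    (d : nat) (rho : pi1 xbar -> 'M[L]_d)
    (rho_cont : continuous_representation rho) :
  exists rhot : pi1 xbar -> 'M[Lt]_d,
    continuous_representation rhot /\
    forall s : pi1 xbar, map_mx pr (rhot s) = rho s.
Proof.
have p_nilp := padic_p_nilpotent p_prime L_artinian L_local L_residue.
have [C0 rhoC0] := representation_factors p_nilp rho_cont.
have [rhoU rhoM _] := rho_cont; have [N pN0] := p_nilp.
(* Size 0 is apart, since [lift_step] uses the ring of square matrices. *)
case: d rho rho_cont rhoC0 rhoU rhoM => [|d] rho _ rhoC0 rhoU rhoM.
  exists (fun=> 1%:M); split=> [|s]; last by rewrite [LHS]flatmx0 [RHS]flatmx0.
  split=> [s|s t|s U sU]; first exact: unitmx1.
    by rewrite mulmx1.
  have B : 'I_0 -> finite_etale A by case.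
  by exists 0%N, B => t _; apply: nbhs_singleton sU.
have prU x : pr x \is a GRing.unit -> x \is a GRing.unit.
  by move=> /local_surjection_unit; apply.
have tf (x : Lt) : p%:R * x = 0 -> x = 0.
  move=> px; apply: (flat_regular Lt_flat (padic_mulp_inj p_prime)).
  by rewrite /scale_by scaler0 scaler_nat -mulr_natl px.
(* Since p^N = 0 in L, every [K k] lies in the kernel of [pr], and each later approximation still
   reduces to [rho]. *)
pose K k : set Lt := pX_ideal (N + k).
have idK k : is_ideal (K k) by apply: is_ideal_pX.
have K_ker k x : K k x -> pr x = 0.
  by move=> [y ->]; rewrite rmorphM rmorphXn rmorph_nat exprD pN0 !mul0r.
have K_fin k := pX_finite_quotient p_prime Lt_finite (N + k).
have Kp k : K k (p ^ (N + k))%:R by exists 1; rewrite mulr1 natrX.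
have idker := is_ideal_ker pr.
pose good k (r : pi1 xbar -> 'M[Lt]_d.+1) :=
  [/\ exists C, factors_through C r, forall g, map_mx pr (r g) = rho g
    & forall g h, cong_mx (K k) (r (pi1_mul g h)) (r g *m r h)].
have cong_pr k r r' : (forall g, map_mx pr (r g) = rho g) ->
    (forall g, cong_mx (K k) (r' g) (r g)) -> forall g, map_mx pr (r' g) = rho g.
  by move=> rE rr g; rewrite -rE; apply/cong_mx_ker => i j; apply: (K_ker k); apply: rr.
(* A set-theoretic section of [pr], applied to the entries of [rho], is multiplicative modulo the
   kernel of [pr]. *)
have [r0 r0good] : exists r, good 0%N r.
  have [sec secK] := choice pr_surj.
  have secE (X : 'M[L]_d.+1) : map_mx pr (map_mx sec X) = X.
    by apply/matrixP=> i j; rewrite !mxE secK.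
  have [|||C [r [rC rM rr]]] := lift_step p_prime (GRing.in_alg A) prU idker (idK 0%N)
     (@K_ker 0%N) (fun x => id) (K_fin 0%N) (Kp 0%N) (C := C0) (r := fun g => map_mx sec (rho g)).
  - by move=> s t st; rewrite (rhoC0 s t st).
  - by move=> g; rewrite secE.
  - by move=> g h; apply/cong_mx_ker; rewrite map_mxM !secE.
  exists r; split=> // [|g]; first by exists C.
  by rewrite -[RHS]secE; apply/cong_mx_ker.
have step k r : good k r -> exists r', good k.+1 r' /\ forall g, cong_mx (K k) (r' g) (r g).
  move=> [[C rC] rE rM].
  have KS x : K k.+1 x -> K k x by apply: pX_idealS; rewrite leq_add2l.
  have [|C' [r' [r'C r'M rr]]] := lift_step p_prime (GRing.in_alg A) prU (idK k) (idK k.+1)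
     KS (K_ker k) (K_fin k.+1) (Kp k.+1) rC _ rM.
    by move=> g; rewrite rE.
  exists r'; split=> //; split=> //; first by exists C'.
  exact: (cong_pr k r).
pose next k (x : {r | good k r}) : {r | good k.+1 r} :=
  let y := cid (step k (sval x) (svalP x)) in exist _ (sval y) (svalP y).1.
pose rs k : {r | good k r} := nat_rect (fun k => {r | good k r}) (exist _ r0 r0good) next k.
pose r k := sval (rs k).
have rS k g : cong_mx (K k) (r k.+1 g) (r k g).
  by rewrite /r /= ; apply: (svalP (cid (step k (sval (rs k)) (svalP (rs k))))).2.
have r_good k : good k (r k) := svalP (rs k).
have limP g i j : exists x, forall k, pX_ideal k (x - r k g i j).
  apply: (pX_complete p_prime Lt_finite (u := fun k => r k g i j)) => k.
  have := rS k g i j; rewrite !mxE; apply: pX_idealS; exact: leq_addl.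
have [rhot rhotP] : exists rhot : pi1 xbar -> 'M[Lt]_d.+1,
    forall g k, cong_mx (pX_ideal k) (rhot g) (r k g).
  exists (fun g => \matrix_(i, j) sval (cid (limP g i j))) => g k i j.
  by rewrite !mxE; apply: (svalP (cid (limP g i j))).
have rhotE g : map_mx pr (rhot g) = rho g.
  have [_ rE _] := r_good (N + 0)%N; rewrite -rE; apply/cong_mx_ker => i j.
  by apply: (K_ker 0%N); apply: rhotP.
have idX k := @is_ideal_pX p Lt k.
exists rhot; split=> //; split=> [g|g h|g U [P gP PU]].
- by rewrite unitmxE prU // -det_map_mx rhotE -unitmxE.
- apply/eqP; rewrite -subr_eq0; apply/eqP/matrixP => i j; rewrite [RHS]mxE.
  apply: (pX_separated p_prime Lt_finite tf) => k.
  have [_ _ rM] := r_good k.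
  apply: (cong_mx_trans (idX k) (rhotP _ k)); apply: (cong_mx_trans (idX k) (Y := r k g *m r k h)).
    by move=> i' j'; apply: pX_idealS (rM g h i' j'); apply: leq_addl.
  by apply: (cong_mxM (idX k)); apply: (cong_mx_sym (idX k)); apply: rhotP.
(* The limit agrees modulo p^k with [r k], which factors through a finite covering; [k] is taken
   large enough for all entries at once. *)
- have ballP i j : exists m, forall b : Lt, pX_ideal m (b - rhot g i j) -> P i j b.
    have [m _ mP] := gP i j; exists m => b [c bc]; apply: mP; exists c.
    by rewrite -bc addrC subrK.
  have [m mP] := choice (fun ij : 'I_d.+1 * 'I_d.+1 => ballP ij.1 ij.2).
  pose k := \max_ij m ij.
  have [[C rC] _ _] := r_good k.
  exists 1%N, (fun=> C) => t tg; apply: PU => i j; apply: (mP (i, j)).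
  apply: (@pX_idealS p Lt _ k); first exact: leq_bigmax.
  have : cong_mx (pX_ideal k) (rhot t) (rhot g).
    apply: (cong_mx_trans (idX k) (rhotP t k)).
    rewrite (rC t g) => [|y]; last exact: (tg ord0).
    by apply: (cong_mx_sym (idX k)); apply: rhotP.
  by move=> /(_ i j); rewrite !mxE.
Qed.
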